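(* There exists a finitely generated group $\Gamma$ that has finite uniform twin-width but is not accessible. In particular, for every finite generating set $S$ of $\Gamma$, the Cayley graph $\mathrm{Cay}(\Gamma;S)$ has finite twin-width but is not accessible.
   Context: **Cayley graphs.** For a group $\Gamma$ and a finite generating set $S$ of $\Gamma$, the Cayley graph $\mathrm{Cay}(\Gamma;S)$ is the graph with vertex set $\Gamma$ and edges $\{g,gs\}$ for $g\in\Gamma$, $s\in S$ (loops are ignored). **Accessibility.** A ray in a graph is an infinite one-way path. Two rays are equivalent if they are joined by infinitely many pairwise disjoint paths. An end is an equivalence class of rays. A locally finite graph $G$ is accessible if there exists a constant $k\in\mathbb{N}$ such that any two distinct ends of $G$ can be separated by at most $k$ edges. A finitely generated group is accessible if one (equivalently, every) Cayley graph of it with respect to a finite generating set is accessible. **Twin-width.** Twin-width here means strict twin-width; for graphs of bounded degree its finiteness is equivalent to finiteness of ordinary twin-width. A vertex identification on a graph $G$ deletes two distinct vertices $u,v\in V(G)$ and adds a new vertex $w$ with neighbourhood $N(w)=(N(u)\cup N(v))\setminus\{u,v\}$. For a finite graph $G$ on $n$ vertices, consider sequences $G=G_n\to G_{n-1}\to\cdots\to G_1$ in which each graph is obtained from the previous one by a vertex identification, so that $G_i$ has $i$ vertices. The width of such a sequence is $\max\{\Delta(G_n),\dots,\Delta(G_1)\}$, where $\Delta$ denotes maximum degree. The strict twin-width of $G$ is the minimum width over all such sequences. The strict twin-width of an infinite graph is the supremum of the strict twin-widths of its finite induced subgraphs. **Uniform twin-width.** Let $(X,<)$ be a linearly ordered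 set and $\sigma$ a permutation of $X$. A $k$-grid in $\sigma$ consists of pairwise disjoint intervals (convex subsets) $I_1<\cdots<I_k$ of $X$ and pairwise disjoint intervals $J_1<\cdots<J_k$ of $X$ such that for all $i,j\in\{1,\dots,k\}$ there is $x\in I_i$ with $\sigma(x)\in J_j$. The uniform twin-width of a group $\Gamma$ is the least $k\in\mathbb{N}$ (or $\infty$ if there is none) for which there is a linear order $<$ on the set $\Gamma$ such that for every $g\in\Gamma$ the permutation $x\mapsto gx$ of $(\Gamma,<)$ has no $(k+1)$-grid. *)

(* Defs.v *)
From mathcomp Require Import all_boot finmap.
From mathcomp Require Import boolp classical_sets.

Set Implicit Arguments.
Unset Strict Implicit.
Unset Printing Implicit Defensive.

Local Open Scope fset_scope.

Lemma ex_asbool (P : nat -> Prop) : (exists n, P n) -> exists n, `[< P n >].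
Proof. by move=> [n Pn]; exists n; apply/asboolP. Qed.

(* The least element of P, where [None] stands for infinity: P is empty. *)
Definition least (P : nat -> Prop) : option nat :=
  match pselect (exists n, P n) with
  | left exP => Some (ex_minn (ex_asbool exP))
  | right _ => None
  end.

Record sgraph (V : Type) := SGraph {
  adj :> rel V;
  adj_sym : symmetric adj;
  adj_irr : irreflexive adj
}.

Definition generates (Gam : groupType) (S : {fset Gam}) : Prop :=
  forall g : Gam, exists w : seq Gam,
    all (fun x => (x \in S) || (x^-1%g \in S)) w /\ g = (\prod_(x <- w) x)%g.

Definition finitely_generated (Gam : groupType) : Prop :=
  exists S : {fset Gam}, generates S.

Section Cayley.
Variables (Gam : groupType) (S : {fset Gam}).

Definition cayley_rel : rel Gam := fun g h =>
  (g != h) && [exists s : S, (h == g * val s)%g || (g == h * val s)%g].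

Lemma cayley_sym : symmetric cayley_rel.
Proof.
move=> g h; rewrite /cayley_rel eq_sym; congr (_ && _).
by apply: eq_existsb => s; rewrite orbC.
Qed.

Lemma cayley_irr : irreflexive cayley_rel.
Proof. by move=> g; rewrite /cayley_rel eqxx. Qed.

Definition cayley : sgraph Gam := SGraph cayley_sym cayley_irr.

End Cayley.

Section Ends.
Variables (V : choiceType) (G : sgraph V).

Definition is_ray (r : nat -> V) : Prop :=
  injective r /\ forall n, G (r n) (r n.+1).

(* The i-th path is the vertex sequence [x i :: p i]; it may consist of a single
   vertex, which then lies on both rays. *)
Definition ray_equiv (r r' : nat -> V) : Prop :=
  exists (x : nat -> V) (p : nat -> seq V),
    (forall i, [/\ path G (x i) (p i), uniq (x i :: p i),
                   exists m, x i = r m & exists n, last (x i) (p i) = r' n]) /\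
    (forall i j, i != j -> ~~ has (mem (x i :: p i)) (x j :: p j)).

Definition is_end (w : set (nat -> V)) : Prop :=
  exists2 r, is_ray r & w = [set r' | is_ray r' /\ ray_equiv r r']%classic.

(* An edge {x, y} may be listed in [F] as (x, y) or as (y, x). *)
Definition del_edges_rel (F : {fset V * V}) : rel V := fun x y =>
  [&& G x y, (x, y) \notin F & (y, x) \notin F].

Lemma del_edges_sym F : symmetric (del_edges_rel F).
Proof. by move=> x y; rewrite /del_edges_rel adj_sym [_ && (_ \notin _)]andbC. Qed.

Lemma del_edges_irr F : irreflexive (del_edges_rel F).
Proof. by move=> x; rewrite /del_edges_rel adj_irr. Qed.

Definition del_edges F : sgraph V := SGraph (del_edges_sym F) (del_edges_irr F).

End Ends.

Definition joined (V : choiceType) (G : sgraph V) (x y : V) : Prop :=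
  exists2 p : seq V, path G x p & last x p = y.

(* No component of G - F contains tails of rays of both ends. *)
Definition separates (V : choiceType) (G : sgraph V) (F : {fset V * V})
    (w w' : set (nat -> V)) : Prop :=
  forall r r', w r -> w' r' ->
    exists N, forall m n, N <= m -> N <= n ->
      ~ joined (del_edges G F) (r m) (r' n).

(* Only meant for locally finite graphs, such as [cayley S]. *)
Definition accessible (V : choiceType) (G : sgraph V) : Prop :=
  exists k : nat, forall w w' : set (nat -> V),
    is_end G w -> is_end G w' -> w <> w' ->
    exists F : {fset V * V},
      [/\ {in F, forall e, G e.1 e.2}, #|` F| <= k & separates G F w w'].

Definition accessible_group (Gam : groupType) : Prop :=
  exists2 S : {fset Gam}, generates S & accessible (cayley S).

Definition max_degree (V : finType) (G : sgraph V) : nat :=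
  \max_(x : V) #|[set y | G x y]%SET|.

Section Identify.
Variables (V : finType) (G : sgraph V) (u v : V).

(* [None] is the new vertex w. *)
Definition ident_vertex : finType := option {x : V | (x != u) && (x != v)}.

Definition identify_rel : rel ident_vertex := fun a b =>
  match a, b with
  | Some x, Some y => G (val x) (val y)
  | Some x, None | None, Some x => G u (val x) || G v (val x)
  | None, None => false
  end.

Lemma identify_sym : symmetric identify_rel.
Proof. by move=> [x|] [y|] //=; rewrite adj_sym. Qed.

Lemma identify_irr : irreflexive identify_rel.
Proof. by move=> [x|] //=; rewrite adj_irr. Qed.

Definition identify : sgraph ident_vertex := SGraph identify_sym identify_irr.

End Identify.

(* Sequences of identifications starting from G and ending with a graph on one
   vertex; the graph on no vertex is given the trivial sequence. *)
Inductive ident_seq : forall V : finType, sgraph V -> Type :=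
| IdentStop (V : finType) (G : sgraph V) : #|V| <= 1 -> ident_seq G
| IdentStep (V : finType) (G : sgraph V) (u v : V) :
    u != v -> ident_seq (identify G u v) -> ident_seq G.

Fixpoint ident_seq_width (V : finType) (G : sgraph V) (s : ident_seq G) : nat :=
  match s with
  | @IdentStop V G _ => max_degree G
  | @IdentStep V G _ _ _ s' => maxn (max_degree G) (ident_seq_width s')
  end.

Lemma card_ident_vertex (V : finType) (u v : V) :
  u != v -> #|ident_vertex u v|.+1 = #|V|.
Proof.
move=> uv; rewrite card_option card_sig.
rewrite -(cardC [set u; v]%SET) cards2 uv; congr _.+2.
by apply: eq_card => x; rewrite !inE negb_or.
Qed.

Lemma ident_seq_width_ex (V : finType) (G : sgraph V) :
  exists n, exists s : ident_seq G, ident_seq_width s = n.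
Proof.
suff [s] : inhabited (ident_seq G) by exists (ident_seq_width s), s.
have [m] := ubnP #|V|; elim: m V G => // m IHm V G ltm.
case: (leqP #|V| 1) => [V1|/card_gt1P[u [v [_ _ uv]]]].
  exact: inhabits (IdentStop G V1).
have [|s] := IHm _ (identify G u v).
  by rewrite -ltnS card_ident_vertex.
exact: inhabits (IdentStep uv s).
Qed.

Definition strict_tww_fin (V : finType) (G : sgraph V) : nat :=
  ex_minn (ex_asbool (ident_seq_width_ex G)).

Section Induced.
Variables (V : choiceType) (G : sgraph V) (A : {fset V}).

Lemma induced_sym : symmetric (fun x y : A => G (val x) (val y)).
Proof. by move=> x y; rewrite adj_sym. Qed.

Lemma induced_irr : irreflexive (fun x y : A => G (val x) (val y)).
Proof. by move=> x; rewrite adj_irr. Qed.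

Definition induced : sgraph A := SGraph induced_sym induced_irr.

End Induced.

(* The supremum, in the naturals with infinity, over finite induced subgraphs. *)
Definition strict_tww (V : choiceType) (G : sgraph V) : option nat :=
  least (fun k => forall A : {fset V}, strict_tww_fin (induced G A) <= k).

Definition strict_linear (X : Type) (lt : X -> X -> Prop) : Prop :=
  [/\ forall x, ~ lt x x,
      forall x y z, lt x y -> lt y z -> lt x z &
      forall x y, [\/ lt x y, x = y | lt y x]].

Definition interval (X : Type) (lt : X -> X -> Prop) (I : set X) : Prop :=
  forall x y z, I x -> I z -> lt x y -> lt y z -> I y.

(* Disjointness of the blocks follows from this, as [lt] is irreflexive. *)
Definition increasing_blocks (X : Type) (lt : X -> X -> Prop) (k : nat)
    (I : 'I_k -> set X) : Prop :=
  (forall i, interval lt (I i)) /\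
  (forall i j : 'I_k, i < j -> forall x y, I i x -> I j y -> lt x y).

Definition has_grid (X : Type) (lt : X -> X -> Prop) (sigma : X -> X) (k : nat)
    : Prop :=
  exists I J : 'I_k -> set X,
    [/\ increasing_blocks lt I, increasing_blocks lt J &
        forall i j, exists2 x, I i x & J j (sigma x)].

Definition uniform_tww (Gam : groupType) : option nat :=
  least (fun k => exists2 lt : Gam -> Gam -> Prop, strict_linear lt &
    forall g : Gam, ~ has_grid lt (fun x => g * x)%g k.+1).

(* Main.v *)
From HB Require Import structures.
Require Import Defs.
From mathcomp Require Import all_boot finmap generic_quotient.
From mathcomp Require Import boolp classical_sets.
From mathcomp Require Import zify.

(** The group is a variant of Dunwoody's inaccessible group. Its generators are
    z, q, t, c; with q_i = t^i q t^-i, z_0 = z and z_(m+1) = [z_m, q_(2m)], the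
    relations say that the q_i are commuting involutions, that c commutes with
    q and t, and that z_m is an involution commuting with q_i for i < 2m. We
    take the largest quotient which is residually binary: any two elements are
    separated by a finite chain of equivalences, invariant under right
    multiplication, each of which cuts the classes of the previous one in at
    most two.

    Both bounds on twin-width follow from residual binarity. Contracting the
    Cayley graph along such a chain keeps the degree bounded. Ordering the group
    lexicographically along countably many chains turns multiplications into
    automorphisms of planar binary trees, which avoid the pattern 2413, hence
    have no 4-grid.

    For inaccessibility, let K be the finite group generated by z_n and the q_i
    with i < 2n. The derivation into the group ring over F_2 which vanishes on
    q, t, c and is inner, given by the sum of K, on the subgroup generated by z
    and the q_i with i < 2n, also vanishes on z_n; so it kills every relator. It
    integrates to a function with finite coboundary, which separates the end of
    the powers of c from its translate by z_(n-1). Yet a path from 1 to z_(n-1)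
    of length O(2^n) has 4^(n-1) translates by the q_i with i < 2(n-1), and all
    of them join these two ends, so few edges cannot separate them. *)

Set Implicit Arguments.
Unset Strict Implicit.
Unset Printing Implicit Defensive.

(** * Binary chains and uniform twin-width *)

Section Binary.
Variables (I X : Type) (act : I -> X -> X).
Implicit Types (bs : seq (X -> bool)) (x y : X).

Definition agree bs x y := all (fun b : X -> bool => b x == b y) bs.

(* The relations [agree] of the suffixes of [bs] form a chain of invariant
   equivalences, each splitting the classes of the previous one in at most two. *)
Fixpoint binary bs : Prop :=
  if bs is b :: bs' then
    binary bs' /\
    forall s x y, agree bs' x y -> b x = b y -> b (act s x) = b (act s y)
  else True.

Definition run x (w : seq I) := foldl (fun y s => act s y) x w.

Lemma run_cat x w w' : run x (w ++ w') = run (run x w) w'.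
Proof. exact: foldl_cat. Qed.

Lemma agreexx bs x : agree bs x x.
Proof. by apply/allP. Qed.

Lemma agree_sym bs x y : agree bs x y = agree bs y x.
Proof. by apply: eq_all => b; rewrite eq_sym. Qed.

Lemma agree_trans bs y x z : agree bs x y -> agree bs y z -> agree bs x z.
Proof.
by elim: bs => //= b bs IH /andP[/eqP-> xy] /andP[-> yz]; exact: IH.
Qed.

Lemma agree_cat bs bs' x y :
  agree (bs ++ bs') x y = agree bs x y && agree bs' x y.
Proof. exact: all_cat. Qed.

Lemma binary_act bs s x y :
  binary bs -> agree bs x y -> agree bs (act s x) (act s y).
Proof.
elim: bs => //= b bs IH [Bbs Hb] /andP[/eqP bxy xy].
by rewrite (Hb s x y) // eqxx IH.
Qed.

Lemma binary_run bs w x y :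
  binary bs -> agree bs x y -> agree bs (run x w) (run y w).
Proof.
by move=> Bbs; elim: w x y => //= s w IH x y xy; apply/IH/binary_act.
Qed.

Lemma binary_cat bs bs' : binary bs -> binary bs' -> binary (bs ++ bs').
Proof.
move=> + Bbs'; elim: bs => //= b bs IH [Bbs Hb]; split; first exact: IH.
by move=> s x y; rewrite agree_cat => /andP[xy _]; exact: Hb.
Qed.

End Binary.

Lemma agree_map (X Y : Type) (f : Y -> X) bs x y :
  agree [seq b \o f | b <- bs] x y = agree bs (f x) (f y).
Proof. exact: all_map. Qed.

(** The word [w] depends on [j] but not on the point, so two points of one class run through the
    same word and stay together. *)
Lemma binary_pullback (I J X Y : Type) (act : I -> X -> X) (act' : J -> Y -> Y)
    (f : Y -> X) (bs : seq (X -> bool)) :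
  binary act bs ->
  (forall j, exists w, forall y, agree bs (f (act' j y)) (run act (f y) w)) ->
  binary act' [seq b \o f | b <- bs].
Proof.
elim: bs => //= b bs IH [Bbs Hb] Hf; split.
  apply: IH => // j; have [w Hw] := Hf j; exists w => y.
  by have /andP[] := Hw y.
move=> j x y; rewrite agree_map => xy bxy; have [w Hw] := Hf j.
have /andP[/eqP-> _] := Hw x; have /andP[/eqP-> _] := Hw y.
have : agree (b :: bs) (run act (f x) w) (run act (f y) w).
  by apply: binary_run => //=; rewrite bxy eqxx.
by case/andP => /eqP.
Qed.

(** The head of the list is the least significant digit, so the classes of each coarser suffix
    occupy intervals of ranks. *)
Definition rank (X : Type) (bs : seq (X -> bool)) (x : X) : nat :=
  foldr (fun (b : X -> bool) n => n.*2 + b x) 0 bs.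

Lemma rank_eq X (bs : seq (X -> bool)) x y :
  (rank bs x == rank bs y) = agree bs x y.
Proof.
elim: bs => //= b bs <-.
by apply/eqP/andP => [H|[/eqP-> /eqP->]//]; split; apply/eqP;
   case: (b x) H; case: (b y) => /= H; lia.
Qed.

Definition rmulg (G : groupType) (g x : G) : G := (x * g)%g.

Lemma binary_rmulg (G : groupType) (bs : seq (G -> bool)) (g x y : G) :
  binary (@rmulg G) bs -> agree bs (x * g)%g (y * g)%g = agree bs x y.
Proof.
move=> Bbs; apply/idP/idP => [|H]; last exact: (@binary_act _ _ (@rmulg G)).
by move/(binary_act g^-1%g Bbs); rewrite /rmulg !mulgK.
Qed.

(* The coarsest bit which is not constant on the four points splits them in the
   same way before and after multiplication by [g]. *)
Lemma rank_no_2413 (G : groupType) (bs : seq (G -> bool)) (g x1 x2 x3 x4 : G) :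
  binary (@rmulg G) bs ->
  rank bs x1 <= rank bs x2 <= rank bs x3 -> rank bs x3 <= rank bs x4 ->
  rank bs (x3 * g)%g <= rank bs (x1 * g)%g <= rank bs (x4 * g)%g ->
  rank bs (x4 * g)%g <= rank bs (x2 * g)%g ->
  [&& agree bs x1 x2, agree bs x1 x3 & agree bs x1 x4].
Proof.
elim: bs => //= b bs IH [Bbs Hb] Hx Hx34 Hy Hy42.
have le2 (m n : nat) (c d : bool) :
  m.*2 + c <= n.*2 + d -> m <= n /\ (m = n -> c <= d).
  by clear; case: c; case: d => /=; lia.
have [/andP[/le2[r12 b12] /le2[r23 b23]] /le2[r34 b34]] := (Hx, Hx34).
have [/andP[/le2[s31 c31] /le2[s14 c14]] /le2[s42 c42]] := (Hy, Hy42).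
have /and3P[A2 A3 A4] : [&& agree bs x1 x2, agree bs x1 x3 & agree bs x1 x4].
  by apply: IH => //; apply/andP.
have eb x y : agree bs x y -> (b (x * g)%g == b (y * g)%g) = (b x == b y).
  move=> xy; apply/eqP/eqP => [E|]; last exact: (Hb g).
  have := Hb g^-1%g (x * g)%g (y * g)%g; rewrite /rmulg !mulgK; apply => //.
  by rewrite binary_rmulg.
have rE x : agree bs x1 x -> rank bs x = rank bs x1.
  by rewrite -rank_eq => /eqP.
have yE x : agree bs x1 x -> rank bs (x * g)%g = rank bs (x1 * g)%g.
  by rewrite -(binary_rmulg g) // -rank_eq => /eqP.
have := eb _ _ A2; have := eb _ _ A3; have := eb _ _ A4.
move: b12 b23 b34 c31 c14 c42.
rewrite (yE _ A2) (yE _ A3) (yE _ A4) (rE _ A2) (rE _ A3) (rE _ A4) A2 A3 A4.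
move=> /(_ erefl) + /(_ erefl) + /(_ erefl) + /(_ erefl) + /(_ erefl) + /(_ erefl).
clear; case: (b x1); case: (b x2) => //; case: (b x3) => //; case: (b x4) => //;
by case: (b (x3 * g)%g); case: (b (x1 * g)%g) => //; case: (b (x4 * g)%g) => //;
   case: (b (x2 * g)%g).
Qed.

Lemma least_neq_None (P : nat -> Prop) : (exists n, P n) -> least P <> None.
Proof. by rewrite /least; case: pselect. Qed.

Section UniformTww.
Variables (G : groupType) (e : nat -> seq (G -> bool)).
Hypothesis Be : forall n, binary (@rmulg G) (e n).
Hypothesis sep_e : forall x y : G, (forall n, agree (e n) x y) -> x = y.

(* The bits are invariant under right multiplication, whence the inverses. *)
Definition lex_lt (x y : G) : Prop :=
  exists n, (forall m, m < n -> agree (e m) x^-1%g y^-1%g) /\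
    rank (e n) x^-1%g < rank (e n) y^-1%g.

(** Agreement below [n] pushes the level deciding [lex_lt] to [n] or beyond, so the ranks at [n] are
    at worst equal. *)
Lemma lex_lt_rank n x y : lex_lt x y ->
  (forall m, m < n -> agree (e m) x^-1%g y^-1%g) ->
  rank (e n) x^-1%g <= rank (e n) y^-1%g.
Proof.
move=> [m [Hm lt_m]] Hn; case: (ltngtP n m) => [nm|mn|->]; last exact: ltnW.
- by have := Hm n nm; rewrite -rank_eq => /eqP->.
- by have := Hn m mn; rewrite -rank_eq => /eqP E; rewrite E ltnn in lt_m.
Qed.

Lemma lex_lt_irr x : ~ lex_lt x x.
Proof. by move=> [n [_]]; rewrite ltnn. Qed.

Lemma lex_lt_trans x y z : lex_lt x y -> lex_lt y z -> lex_lt x z.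
Proof.
move=> [n [Hn xy]] [m [Hm yz]].
have rE k u v : agree (e k) u v -> rank (e k) u = rank (e k) v.
  by rewrite -rank_eq => /eqP.
case: (ltngtP n m) => [nm|mn|E].
- exists n; split; last by rewrite -(rE _ _ _ (Hm _ nm)).
  by move=> k kn; apply: agree_trans (Hn k kn) (Hm k (ltn_trans kn nm)).
- exists m; split; last by rewrite (rE _ _ _ (Hn _ mn)).
  by move=> k km; apply: agree_trans (Hn k (ltn_trans km mn)) (Hm k km).
- subst m; exists n; split; last exact: ltn_trans yz.
  by move=> k kn; apply: agree_trans (Hn k kn) (Hm k kn).
Qed.

Lemma lex_lt_total x y : [\/ lex_lt x y, x = y | lex_lt y x].
Proof.
case: (pselect (exists n, ~~ agree (e n) x^-1%g y^-1%g)) => [ex|nex].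
  case: (ex_minnP ex) => n nA min_n.
  have Hn m : m < n -> agree (e m) x^-1%g y^-1%g.
    by move=> mn; apply: contraLR mn => /min_n; rewrite -leqNgt.
  move: nA; rewrite -rank_eq neq_ltn => /orP[H|H]; first by constructor 1; exists n.
  by constructor 3; exists n; split=> // m mn; rewrite agree_sym Hn.
constructor 2; apply: invg_inj; apply: sep_e => n.
by apply: contrapT => nA; apply: nex; exists n; apply/negP.
Qed.

(** Agreement of the four inverses at earlier levels makes their ranks at level [n] weakly ordered,
    before and after multiplication, so [rank_no_2413] gives agreement at [n]. Agreement at every
    level contradicts [lex_lt x1 x4]. *)
Lemma lex_lt_no_2413 g x1 x2 x3 x4 :
  lex_lt x1 x2 -> lex_lt x2 x3 -> lex_lt x3 x4 ->
  lex_lt (g * x3)%g (g * x1)%g -> lex_lt (g * x1)%g (g * x4)%g ->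
  lex_lt (g * x4)%g (g * x2)%g -> False.
Proof.
move=> x12 x23 x34 y31 y14 y42.
have x14 : lex_lt x1 x4 by apply: lex_lt_trans x34; apply: lex_lt_trans x23.
suff A n : [&& agree (e n) x1^-1 x2^-1, agree (e n) x1^-1 x3^-1
             & agree (e n) x1^-1 x4^-1]%g.
  by case: x14 => n [_]; have /and3P[_ _] := A n; rewrite -rank_eq => /eqP->;
     rewrite ltnn.
elim/ltn_ind: n => n IH.
have tr k u v w : agree (e k) u v -> agree (e k) u w -> agree (e k) v w.
  by rewrite agree_sym; exact: agree_trans.
have {}x12 : rank (e n) x1^-1%g <= rank (e n) x2^-1%g.
  by apply: lex_lt_rank => // m /IH/and3P[].
have {}x23 : rank (e n) x2^-1%g <= rank (e n) x3^-1%g.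
  by apply: lex_lt_rank => // m /IH/and3P[H2 H3 _]; exact: tr H3.
have {}x34 : rank (e n) x3^-1%g <= rank (e n) x4^-1%g.
  by apply: lex_lt_rank => // m /IH/and3P[_]; exact: tr.
have {}y31 : rank (e n) (x3^-1 * g^-1)%g <= rank (e n) (x1^-1 * g^-1)%g.
  rewrite -!invgM; apply: lex_lt_rank => // m /IH/and3P[_ H3 _].
  by rewrite !invgM binary_rmulg // agree_sym.
have {}y14 : rank (e n) (x1^-1 * g^-1)%g <= rank (e n) (x4^-1 * g^-1)%g.
  rewrite -!invgM; apply: lex_lt_rank => // m /IH/and3P[].
  by rewrite !invgM binary_rmulg.
have {}y42 : rank (e n) (x4^-1 * g^-1)%g <= rank (e n) (x2^-1 * g^-1)%g.
  rewrite -!invgM; apply: lex_lt_rank => // m /IH/and3P[H2 _ H4].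
  by rewrite !invgM binary_rmulg //; exact: tr H2.
by apply: (@rank_no_2413 _ _ g^-1%g) => //; apply/andP.
Qed.

Lemma uniform_tww_finite : uniform_tww G <> None.
Proof.
apply: least_neq_None; exists 3, lex_lt.
  by split; [exact: lex_lt_irr|exact: lex_lt_trans|exact: lex_lt_total].
move=> g [I [J [[_ ltI] [_ ltJ] H]]].
pose o k (k4 : k < 4) : 'I_4 := Ordinal k4.
(* These four cells of a 4-grid spell the pattern 2413. *)
have [x1 I1 J1] := H (o 0 isT) (o 1 isT).
have [x2 I2 J2] := H (o 1 isT) (o 3 isT).
have [x3 I3 J3] := H (o 2 isT) (o 0 isT).
have [x4 I4 J4] := H (o 3 isT) (o 2 isT).
apply: (@lex_lt_no_2413 g x1 x2 x3 x4).
- exact: ltI I1 I2.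
- exact: ltI I2 I3.
- exact: ltI I3 I4.
- exact: ltJ J3 J1.
- exact: ltJ J1 J4.
- exact: ltJ J4 J2.
Qed.

End UniformTww.

(** * Strict twin-width of Cayley graphs *)

(** Pigeonhole for a relation: every element picks a partner, and no partner serves two elements. *)
Lemma size_le_of_rel (A B : eqType) (s : seq A) (K : seq B) (R : A -> B -> Prop) :
  uniq s -> {in s, forall a, exists2 y, y \in K & R a y} ->
  {in s &, forall a a' y, R a y -> R a' y -> a = a'} -> size s <= size K.
Proof.
case: s => // a0 s0; set s := a0 :: s0 => Us HK Rinj.
have [y0 _ _] := HK a0 (mem_head _ _).
have /choice[g Hg] : forall a, exists y, a \in s -> y \in K /\ R a y.
  move=> a; case: (boolP (a \in s)) => [/HK[y]|_]; last by exists y0.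
  by exists y.
rewrite -(size_map g); apply: uniq_leq_size.
  rewrite map_inj_in_uniq // => a a' /[dup] sa /Hg[_ Ra] /[dup] sa' /Hg[_ Ra'] E.
  by apply: Rinj Ra _ => //; rewrite E.
by move=> _ /mapP[a sa ->]; case: (Hg a sa).
Qed.

Definition residually_binary (G : groupType) : Prop :=
  forall x y : G, x <> y ->
    exists2 bs, binary (@rmulg G) bs & ~~ agree bs x y.

Lemma residually_binary_seq (G : groupType) (l : seq G) :
  residually_binary G ->
  exists2 bs, binary (@rmulg G) bs & {in l &, forall x y, agree bs x y -> x = y}.
Proof.
move=> res.
suff [bs Bbs Hbs] : exists2 bs, binary (@rmulg G) bs &
    forall p, p \in [seq (x, y) | x <- l, y <- l] -> agree bs p.1 p.2 -> p.1 = p.2.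
  by exists bs => // x y xl yl; apply: (Hbs (x, y)); exact: allpairs_f.
elim: [seq _ | x <- l, y <- l] => [|[x y] ps [bs Bbs IH]]; first by exists [::].
case: (pselect (x = y)) => [xy|/res[bs' Bbs' Hbs']].
  by exists bs => // p /[1!inE] /orP[/eqP->|/IH].
exists (bs' ++ bs) => [|p]; first exact: binary_cat.
rewrite inE agree_cat => /orP[/eqP->|/IH] /=; first by rewrite (negPf Hbs').
by move=> + /andP[_]; exact.
Qed.

Section StrictTww.
Variables (G : groupType) (T : seq G).

(** Two halves of a blob times the steps in [T]. The extra one absorbs the crude bound used for a
    graph on at most one vertex when [T] is empty. *)
Definition width_bound := ((size T).*2).+1.

Section Level.
Variables (b : G -> bool) (bs : seq (G -> bool)).
Hypothesis Bb : binary (@rmulg G) (b :: bs).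

(* A vertex of an intermediate graph stands for the class of [f v] for
   [b :: bs], or for [bs] if it has already been merged. *)
Definition blob (V : Type) (f : V -> G) (merged : V -> bool) (v : V) (x : G) :=
  agree (if merged v then bs else b :: bs) (f v) x.

Definition blob_graph (V : finType) (H : sgraph V) f merged : Prop :=
  (forall v w x, blob f merged v x -> blob f merged w x -> v = w) /\
  (forall v w, H v w -> exists x t,
     [/\ t \in T, blob f merged v x & blob f merged w (x * t)%g]).

Lemma blob_agree V (f : V -> G) merged v x : blob f merged v x -> agree bs (f v) x.
Proof. by rewrite /blob; case: (merged v) => //= /andP[]. Qed.

Lemma blob_agreer V (f : V -> G) merged v x y :
  agree (b :: bs) x y -> blob f merged v x -> blob f merged v y.
Proof.
move=> xy; rewrite /blob => vx; apply: agree_trans vx _.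
by case: (merged v) => //; case/andP: xy.
Qed.

(** A blob consists of at most two classes of [b :: bs], told apart by [b]. A step [t] carries a
    class into a single class, so the pair of a bit and a step determines the neighbour. *)
Lemma blob_graph_degree (V : finType) (H : sgraph V) f merged :
  blob_graph H f merged -> max_degree H <= width_bound.
Proof.
move=> [dis edge]; apply/bigmax_leqP => v _; apply: leqW.
have -> : (size T).*2 = size [seq (c, t) | c <- [:: true; false], t <- T].
  by rewrite size_allpairs mul2n.
rewrite cardE.
apply: (@size_le_of_rel _ _ _ _ (fun w (ct : bool * G) => exists x,
  [/\ blob f merged v x, b x = ct.1 & blob f merged w (x * ct.2)%g])).
- exact: enum_uniq.
- move=> w; rewrite mem_enum inE => /edge[x [t [tT vx wx]]].
  exists (b x, t); last by exists x.
  by apply: allpairs_f => //; rewrite !inE; case: (b x).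
- move=> w w' _ _ [c t] [x [vx /= bx wx]] [x' [vx' /= bx' wx']].
  apply: dis wx'; apply: blob_agreer wx; rewrite binary_rmulg //= bx bx' eqxx.
  by apply: agree_trans (blob_agree vx'); rewrite agree_sym; exact: blob_agree vx.
Qed.

Lemma blob_graph_identify (V : finType) (H : sgraph V) f merged (u v : V) :
  blob_graph H f merged -> u != v -> merged u = false -> merged v = false ->
  agree bs (f u) (f v) ->
  blob_graph (identify H u v)
    (fun a => if a is Some x then f (val x) else f u)
    (fun a => if a is Some x then merged (val x) else true).
Proof.
move=> [dis edge] uv mu mv fuv.
(* [u] and [v] are the two halves of one class of [bs]. Together they fill it, so no other blob
   meets it ([Nblob]). *)
have buv : b (f v) = ~~ b (f u).
  suff: b (f u) != b (f v) by case: (b (f u)); case: (b (f v)).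
  apply: contra uv => bE; apply/eqP/(dis _ _ (f v)).
    by rewrite /blob mu /= bE.
  by rewrite /blob mv agreexx.
have Nblob (w : {x : V | (x != u) && (x != v)}) x :
    agree bs (f u) x -> ~ blob f merged (val w) x.
  move=> ux wx; have /andP[wu wv] := valP w.
  case: (eqVneq (b x) (b (f u))) => [bx|bx].
    by case/eqP: wu; apply: dis wx _; rewrite /blob mu /= bx eqxx.
  case/eqP: wv; apply: dis wx _; rewrite /blob mv /= buv.
  apply/andP; split; first by case: (b x) bx; case: (b (f u)).
  by apply: agree_trans ux; rewrite agree_sym.
split.
  move=> [w|] [w'|] x //.
  - by move=> wx w'x; congr Some; apply/val_inj/(dis _ _ x).
  - by move=> wx ux; case: (Nblob w x ux).
  - by move=> ux wx; case: (Nblob w' x ux).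
have Hu x : blob f merged u x -> agree bs (f u) x by exact: blob_agree.
have Hv x : blob f merged v x -> agree bs (f u) x.
  by move=> vx; apply: agree_trans fuv (blob_agree vx).
move=> [w|] [w'|] //=.
- exact: edge.
- rewrite ![H _ (val w)]adj_sym.
  by case/orP => /edge[x [t [tT wx ux]]]; exists x, t; split=> //;
     [exact: Hu ux|exact: Hv ux].
- by case/orP => /edge[x [t [tT ux wx]]]; exists x, t; split=> //;
     [exact: Hu ux|exact: Hv ux].
Qed.

End Level.

Definition class_graph (bs : seq (G -> bool)) (V : finType) (H : sgraph V) f :=
  (forall v w x, agree bs (f v) x -> agree bs (f w) x -> v = w) /\
  (forall v w : V, H v w -> exists x t,
     [/\ t \in T, agree bs (f v) x & agree bs (f w) (x * t)%g]).

(** To coarsen [b :: bs] to [bs], sibling halves are merged one pair at a time, by an inner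
    induction on the number of vertices; every intermediate graph is a blob graph and so has bounded
    degree. *)
Lemma ident_seq_class_graph bs (V : finType) (H : sgraph V) f :
  binary (@rmulg G) bs -> class_graph bs H f ->
  exists s : ident_seq H, ident_seq_width s <= width_bound.
Proof.
elim: bs V H f => [|b bs IH] V H f Bb [dis edge].
  have V1 : #|V| <= 1 by apply/card_le1_eqP => x y _ _; apply: (dis _ _ 1%g).
  exists (IdentStop H V1) => /=; apply/bigmax_leqP => x _.
  by apply: leq_trans (max_card _) (leq_trans V1 _).
suff: forall m (merged : V -> bool), #|V| <= m -> blob_graph b bs H f merged ->
    exists s : ident_seq H, ident_seq_width s <= width_bound.
  by move/(_ _ (fun=> false) (leqnn _)); apply.
move=> m; elim: m V H f {dis edge} => [|m IHm] V H f merged Vm bH.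
  have V1 : #|V| <= 1 by exact: leq_trans Vm _.
  exists (IdentStop H V1) => /=; exact (blob_graph_degree Bb bH).
case: (pselect (exists u v : V, [/\ u != v, merged u = false, merged v = false
                             & agree bs (f u) (f v)])).
  move=> [u [v [uv mu mv fuv]]].
  have [|s Hs] := IHm _ _ _ _ _ (blob_graph_identify bH uv mu mv fuv).
    by rewrite -ltnS card_ident_vertex.
  exists (IdentStep uv s) => /=; rewrite geq_max Hs andbT.
  exact (blob_graph_degree Bb bH).
(* With no pair left to merge, distinct blobs lie in distinct classes of [bs], so the graph is
   already a class graph for [bs]. *)
move=> nex; apply: (IH _ _ f); first by case: Bb.
have [dis edge] := bH; split=> [v w x vx wx|v w /edge[x [t [tT vx wx]]]].
  have vw : agree bs (f v) (f w) by apply: agree_trans vx _; rewrite agree_sym.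
  case Ev: (merged v).
    by apply: (dis _ _ (f w)); rewrite /blob ?Ev // agreexx.
  case Ew: (merged w).
    by apply: (dis _ _ (f v)); rewrite /blob ?Ew ?agreexx // agree_sym.
  by apply: contrapT => /eqP vNw; apply: nex; exists v, w.
by exists x, t; split=> //; [exact: blob_agree vx|exact: blob_agree wx].
Qed.

End StrictTww.

Lemma strict_tww_fin_le (V : finType) (H : sgraph V) n :
  (exists s : ident_seq H, ident_seq_width s <= n) -> strict_tww_fin H <= n.
Proof.
move=> [s sn]; rewrite /strict_tww_fin; case: ex_minnP => m _ Hm.
by apply: leq_trans (Hm _ _) sn; apply/asboolP; exists s.
Qed.

Lemma cayleyP (G : groupType) (S : {fset G}) (x y : G) :
  reflect (x <> y /\ exists2 t, (t \in S) || (t^-1%g \in S) & y = (x * t)%g)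
          (cayley S x y).
Proof.
apply: (iffP andP) => -[/eqP xy].
  case/existsP=> s /orP[] /eqP E; split=> //.
    by exists (val s) => //; rewrite (valP s).
  exists (val s)^-1%g; last by rewrite E mulgK.
  by rewrite invgK (valP s) orbT.
move=> [t tS E]; split=> //.
apply/existsP; case/orP: tS => tS; exists [` tS]%fset => /=.
  by rewrite E eqxx.
by rewrite E mulgK eqxx orbT.
Qed.

(** The chain separating the finite vertex set varies with [A], but the bound depends on [S] alone.
    [T] contains the inverses because edges are read in both directions. *)
Lemma strict_tww_finite (G : groupType) (S : {fset G}) :
  residually_binary G -> strict_tww (cayley S) <> None.
Proof.
move=> res; apply: least_neq_None.
pose T := enum_fset S ++ [seq x^-1%g | x <- enum_fset S].
exists (width_bound T) => A; apply: strict_tww_fin_le.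
have [bs Bbs Hbs] := residually_binary_seq (enum_fset A) res.
apply: (@ident_seq_class_graph G T bs _ _ (fun v : A => val v)) => //; split.
  move=> v w x vx wx; apply/val_inj/Hbs; rewrite ?fsvalP //.
  by apply: agree_trans vx _; rewrite agree_sym.
move=> v w /cayleyP[_ [t tS E]]; exists (val v), t.
split; rewrite ?agreexx -?E ?agreexx //.
rewrite mem_cat; case/orP: tS => [-> //|tS].
by rewrite -[t in X in _ || X]invgK map_f ?orbT.
Qed.

(** * Rays and ends *)

Lemma eventually_all (T : eqType) (l : seq T) (P : T -> nat -> Prop) :
  (forall x, x \in l -> exists N, forall n, N <= n -> P x n) ->
  exists N, forall n, N <= n -> forall x, x \in l -> P x n.
Proof.
elim: l => [|y l IH] H; first by exists 0.
have [|N HN] := IH; first by move=> x xl; apply: H; rewrite inE xl orbT.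
have [M HM] := H y (mem_head _ _).
exists (maxn M N) => n; rewrite geq_max => /andP[Mn Nn] x /[1!inE] /orP[/eqP->|].
  exact: HM.
exact: HN.
Qed.

Lemma injective_eventually_notin (T : eqType) (r : nat -> T) (l : seq T) :
  injective r -> exists N, forall n, N <= n -> r n \notin l.
Proof.
move=> rI; have [|N HN] := @eventually_all _ l (fun x n => r n != x).
  move=> x _; case: (pselect (exists m, r m = x)) => [[m <-]|nex].
    by exists m.+1 => n mn; apply/eqP => /rI E; rewrite E ltnn in mn.
  by exists 0 => n _; apply/eqP => E; apply: nex; exists n.
by exists N => n /HN Hn; apply/negP => /Hn /eqP.
Qed.

Section Connection.
Variables (V : choiceType) (G : sgraph V).
Implicit Types (U : V -> Prop) (x y z : V) (r : nat -> V).

Definition conn U x y :=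
  exists p, [/\ path G x p, last x p = y & forall v, v \in x :: p -> U v].

Lemma conn_refl U x : U x -> conn U x x.
Proof. by move=> Ux; exists [::]; split=> // v /[1!inE] /eqP->. Qed.

Lemma conn_edge U x y : U x -> U y -> G x y -> conn U x y.
Proof.
move=> Ux Uy xy; exists [:: y]; split=> //=; first by rewrite xy.
by move=> v; rewrite !inE => /orP[] /eqP->.
Qed.

Lemma conn_trans U y x z : conn U x y -> conn U y z -> conn U x z.
Proof.
move=> [p [xp <- Up]] [p' [yp' <- Up']]; exists (p ++ p'); split.
- by rewrite cat_path xp.
- by rewrite last_cat.
- move=> v; rewrite -cat_cons mem_cat => /orP[/Up //|vp'].
  by apply: Up'; rewrite inE vp' orbT.
Qed.

Lemma conn_sym U x y : conn U x y -> conn U y x.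
Proof.
move=> [p [xp <- Up]]; exists (rev (belast x p)); split.
- by rewrite rev_path (eq_path (e' := G)) // => a b; rewrite adj_sym.
- by case: p {xp Up} => //= a p; rewrite rev_cons last_rcons.
- move=> v Hv; apply: Up; rewrite lastI mem_rcons.
  by rewrite !inE mem_rev in Hv *.
Qed.

Lemma conn_joined U (F : {fset V * V}) x y :
  (forall e, e \in F -> ~ U e.1) -> conn U x y -> joined (del_edges G F) x y.
Proof.
move=> FU [p [xp yp Up]]; exists p => //; elim: p x xp Up {yp} => //= z p IH x.
move=> /andP[xz zp] Up; rewrite IH // => [|v vp]; last first.
  by apply: Up; rewrite inE vp orbT.
rewrite andbT /del_edges_rel xz /=.
have H a b : a \in x :: z :: p -> (a, b) \notin F.
  by move=> /Up Ua; apply/negP => /FU.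
by rewrite !H // !inE eqxx ?orbT.
Qed.

Lemma conn_ray U r n :
  is_ray G r -> (forall m, U (r m)) -> conn U (r 0) (r n).
Proof.
move=> [_ rG] Ur; elim: n => [|n IH]; first exact: conn_refl.
by apply: conn_trans IH _; exact: conn_edge.
Qed.

(** Each vertex lies in only finitely many [D n], so the paths thin out to a pairwise disjoint
    subfamily. *)
Lemma ray_equiv_conn r r' (D : nat -> seq V) :
  (forall n, conn (fun v => v \in D n) (r n) (r' n)) ->
  (forall x, exists N, forall n, N <= n -> x \notin D n) ->
  ray_equiv G r r'.
Proof.
move=> rr' finD.
have /choice[P HP] : forall n, exists p, [/\ path G (r n) p, uniq (r n :: p),
    last (r n) p = r' n & {subset r n :: p <= D n}].
  move=> n; have [p [rp + pD]] := rr' n.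
  have /= := @shortenP _ G (r n) p rp; case=> p' rp' Up' pp' E.
  exists p'; split=> // v; rewrite inE => /orP[/eqP->|/pp' vp].
    by apply: pD; rewrite mem_head.
  by apply: pD; rewrite inE vp orbT.
have /choice[nxt Hnxt] : forall n, exists N, forall m, N <= m ->
    forall k x, k <= n -> x \in D k -> x \notin D m.
  move=> n; have [|N HN] := @eventually_all _ (flatten [seq D k | k <- iota 0 n.+1])
      (fun x m => x \notin D m).
    by move=> x _; exact: finD.
  exists N => m /HN Hm k x kn xk; apply: Hm; apply/flatten_mapP.
  by exists k => //; rewrite mem_iota.
(* Greedy selection: from [nxt n] on, the sets are disjoint from every [D k] with [k <= n]; the
   maximum with [n.+1] keeps the indices increasing. *)
pose idx i := iter i (fun n => maxn (nxt n) n.+1) 0.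
have idx_mono i j : i <= j -> idx i <= idx j.
  elim: j => [|j IH]; first by rewrite leqn0 => /eqP->.
  rewrite leq_eqVlt => /orP[/eqP->//|/IH ij]; apply: leq_trans ij _.
  by rewrite /idx /= leq_max leqnSn orbT.
have dis i j v : i < j -> v \in D (idx i) -> v \notin D (idx j).
  case: j => // j ij; apply: (Hnxt (idx j)); last exact: idx_mono.
  by rewrite /idx /= leq_maxl.
exists (fun i => r (idx i)), (fun i => P (idx i)); split.
  by move=> i; have [? ? E _] := HP (idx i); split=> //; exists (idx i).
move=> i j ij; apply/hasPn => v vj; apply/negP => /= vi.
have [_ _ _ /(_ _ vi) {}vi] := HP (idx i); have [_ _ _ /(_ _ vj) {}vj] := HP (idx j).
move: ij; rewrite neq_ltn => /orP[] H.
  by have := dis _ _ _ H vi; rewrite vj.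
by have := dis _ _ _ H vj; rewrite vi.
Qed.

Lemma path_crossing (f : V -> bool) (B : seq V) x p :
  (forall y z, G y z -> f y != f z -> y \in B) ->
  path G x p -> f x != f (last x p) -> exists2 v, v \in x :: p & v \in B.
Proof.
move=> HB; elim: p x => [|y p IH] x /=; first by rewrite eqxx.
move=> /andP[xy yp] fxl; case: (eqVneq (f x) (f y)) => [E|]; last first.
  by exists x; [rewrite mem_head|exact: HB xy _].
have [|v vp vB] := IH y yp; first by rewrite -E.
by exists v => //; rewrite inE vp orbT.
Qed.

(** A connecting path starts or ends on a finite initial segment of a ray, or else [f] changes along
    it, which happens in [B]. All of them meet the finite list [C], which bounds the number of
    disjoint ones. *)
Lemma not_ray_equiv (f : V -> bool) (B : seq V) r r' :
  (forall y z, G y z -> f y != f z -> y \in B) ->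
  (exists N, forall n, N <= n -> ~~ f (r n)) ->
  (exists N, forall n, N <= n -> f (r' n)) ->
  ~ ray_equiv G r r'.
Proof.
move=> HB [N HN] [M HM] [x [p [Hp dis]]].
pose C := B ++ [seq r n | n <- iota 0 N] ++ [seq r' n | n <- iota 0 M].
suff : size (iota 0 (size C).+1) <= size C by rewrite size_iota ltnn.
apply: (@size_le_of_rel _ _ _ _ (fun i v => v \in x i :: p i)) => [|i _|i j _ _ v vi vj].
- exact: iota_uniq.
- have [xp _ [m xm] [n ln]] := Hp i.
  case: (ltnP m N) => [mN|/HN fm].
    exists (x i); last exact: mem_head.
    by rewrite xm !mem_cat map_f ?orbT // mem_iota.
  case: (ltnP n M) => [nM|/HM fn].
    exists (last (x i) (p i)); last exact: mem_last.
    by rewrite ln !mem_cat [_ \in [seq r' _ | _ <- _]]map_f ?orbT // mem_iota.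
  have [|v vp vB] := path_crossing HB xp; last by exists v; rewrite // mem_cat vB.
  by rewrite ln fn xm (negPf fm).
- apply/eqP; apply: contraT => /dis/hasPn/(_ v vj) /=.
  by rewrite inE in vi *; rewrite vi.
Qed.

(** Loop erasure by last visits: [L j] is the last time the walk is at [W j], and the ray continues
    with the last visit to the vertex that follows. *)
Lemma loop_erased_ray (W : nat -> V) :
  (forall n, W n = W n.+1 \/ G (W n) (W n.+1)) ->
  (forall x, exists N, forall n, N <= n -> W n != x) ->
  exists r, [/\ is_ray G r, r 0 = W 0 & forall n, exists m, r n = W m].
Proof.
move=> stepW finW.
have /choice[L HL] : forall j, exists k, [/\ j <= k, W k = W j &
    forall i, k < i -> W i != W j].
  move=> j; have [N HN] := finW (W j).
  have ex : exists k, W k == W j by exists j.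
  have bound k : W k == W j -> k <= N.
    by move=> E; rewrite leqNgt; apply/negP => /ltnW /HN; rewrite E.
  case: (ex_maxnP ex bound) => k /eqP kj kmax; exists k; split=> //.
    exact: kmax.
  by move=> i; apply: contraTN => /kmax; rewrite -leqNgt.
pose t n := iter n (fun i => L i.+1) (L 0).
have Wt n i : t n < i -> W i != W (t n).
  by rewrite /t; case: n => [|n] /= ti; [have [_ -> H] := HL 0|
    have [_ -> H] := HL (t n).+1]; exact: H.
have Wt_next n : W (t n.+1) = W (t n).+1 by have [] := HL (t n).+1.
have t_lt m n : m < n -> t m < t n.
  elim: n => // n IH; rewrite ltnS leq_eqVlt => mn.
  have tn : t n < t n.+1 by have [] := HL (t n).+1.
  by case/orP: mn => [/eqP->//|/IH]; move/ltn_trans; apply.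
exists (fun n => W (t n)); split; last by move=> n; exists (t n).
  split=> [m n|n].
    by case: (ltngtP m n) => // /t_lt /Wt /eqP H E; case: H.
  rewrite Wt_next; case: (stepW (t n)) => // E.
  by have := Wt n _ (ltnSn _); rewrite -E eqxx.
by have [] := HL 0.
Qed.

End Connection.

(** * Words, translations and rays in Cayley graphs *)

Section CayleyGraph.
Variables (G : groupType) (S : {fset G}).
Hypothesis genS : generates S.
Implicit Types (x y g : G) (U : G -> Prop) (w : seq G).

Definition step (t : G) := (t \in S) || (t^-1%g \in S).

Fixpoint prefixes w : seq G :=
  if w is s :: w' then 1%g :: [seq (s * p)%g | p <- prefixes w'] else [:: 1%g].

Lemma size_prefixes w : size (prefixes w) = (size w).+1.
Proof. by elim: w => //= s w IH; rewrite size_map IH. Qed.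

Lemma mem1_prefixes w : 1%g \in prefixes w.
Proof. by case: w => [|s w]; rewrite mem_head. Qed.

Lemma cayley_step x s : step s -> x = (x * s)%g \/ cayley S x (x * s)%g.
Proof.
move=> sS; case: (eqVneq x (x * s)%g) => [|/eqP]; [by left|right].
by apply/cayleyP; split=> //; exists s.
Qed.

Lemma cayley_mull g x y : cayley S (g * x)%g (g * y)%g = cayley S x y.
Proof.
apply/cayleyP/cayleyP => -[xy [t tS E]]; split=> //.
- by move=> E'; apply: xy; rewrite E'.
- by exists t => //; apply: (mulgI g); rewrite E mulgA.
- by move/mulgI.
- by exists t => //; rewrite E mulgA.
Qed.

Lemma conn_word U x w :
  all step w -> (forall p, p \in prefixes w -> U (x * p)%g) ->
  conn (cayley S) U x (x * \prod_(s <- w) s)%g.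
Proof.
elim: w x => [|s w IH] x /=.
  rewrite big_nil mulg1 => _ H; apply: conn_refl; rewrite -[x]mulg1; apply: H.
  exact: mem_head.
move=> /andP[sS wS] H; have Ux : U x.
  by rewrite -[x]mulg1; apply: H; rewrite mem_head.
have Uw p : p \in prefixes w -> U (x * s * p)%g.
  by move=> pw; rewrite -mulgA; apply: H; rewrite inE map_f ?orbT.
rewrite big_cons mulgA; apply: (@conn_trans _ _ _ (x * s)%g); last exact: IH.
have Uxs : U (x * s)%g by rewrite -[(x * s)%g]mulg1; apply: Uw; exact: mem1_prefixes.
by have [<-|xs] := cayley_step x sS; [exact: conn_refl|exact: conn_edge].
Qed.

Lemma conn_mulr g :
  exists D : seq G, forall x U, (forall p, p \in D -> U (x * p)%g) ->
    conn (cayley S) U x (x * g)%g.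
Proof.
have [w [wS ->]] := genS g.
by exists (prefixes w) => x U; exact: conn_word.
Qed.

Lemma is_ray_mull r g :
  is_ray (cayley S) r -> is_ray (cayley S) (fun n => g * r n)%g.
Proof.
move=> [rI rG]; split=> [m n /mulgI /rI //|n].
by rewrite cayley_mull.
Qed.

(** A word for [c] read over and over gives a walk. It visits each vertex finitely often since the
    powers of [c] are distinct, and its loop erasure is the ray; [P] lists the prefixes of the
    word. *)
Lemma ray_along_powers (c : G) :
  injective (fun i => c ^+ i)%g ->
  exists r (P : seq G), [/\ is_ray (cayley S) r, r 0 = 1%g &
    forall n, exists i, exists2 p, p \in P & r n = (c ^+ i * p)%g].
Proof.
move=> cI; have [v [vS cE]] := genS c.
have v_gt0 : 0 < size v.
  case: v cE {vS} => //; rewrite big_nil => c1.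
  by have : 0 = 1 by apply: cI; rewrite c1 !expg1n.
pose pre k := (\prod_(s <- take k v) s)%g.
pose W j := (c ^+ (j %/ size v) * pre (j %% size v))%g.
have preS k : k < size v -> pre k.+1 = (pre k * nth 1 v k)%g.
  by move=> kv; rewrite /pre (take_nth 1%g) // -cats1 big_cat big_seq1.
have WS j : W j.+1 = (W j * nth 1 v (j %% size v))%g.
  have jv : j %% size v < size v by rewrite ltn_mod.
  rewrite /W -mulgA -preS //.
  have E : j.+1 = j %/ size v * size v + (j %% size v).+1 by rewrite addnS -divn_eq.
  case: (ltngtP (j %% size v).+1 (size v)) => [lt|gt|eq].
  - by rewrite {1 2}E divnMDl // modnMDl (divn_small lt) addn0 (modn_small lt).
  - by lia.
  - rewrite {1 2}E eq -mulSnr mulnK // modnMl {2}/pre take_size -cE expgSr.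
    by rewrite /pre take0 big_nil mulg1.
have [||r [rR r0 rW]] := @loop_erased_ray _ (cayley S) W.
- move=> j; rewrite WS; apply: cayley_step; apply: (allP vS); apply: mem_nth.
  by rewrite ltn_mod.
- move=> x; pose l := [seq (x * (pre k)^-1)%g | k <- iota 0 (size v)].
  have [N HN] := injective_eventually_notin l cI; exists (N * size v) => j Nj.
  have /HN : N <= j %/ size v by rewrite leq_divRL.
  apply: contraNneq => E; apply/mapP; exists (j %% size v).
    by rewrite mem_iota ltn_mod.
  by rewrite -E /W mulgK.
exists r, [seq pre k | k <- iota 0 (size v)]; split=> // [|n].
  by rewrite r0 /W div0n mod0n /pre take0 big_nil mulg1.
have [m ->] := rW n; exists (m %/ size v), (pre (m %% size v)) => //.
by apply: map_f; rewrite mem_iota ltn_mod.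
Qed.

End CayleyGraph.

(* Let [g] be the product of [obs_u]. The function [obs_f] separates the end of
   the powers of [c] from its translate by [g], but these ends are joined by all
   translates by [obs_Q] of the path from 1 to [g] spelled by [obs_u]. *)
Record obstruction (G : groupType) (c : G) (S0 : seq G) (N : nat) := Obstruction {
  obs_Q : seq G;
  obs_u : seq G;
  obs_f : G -> bool;
  obs_uniq : uniq obs_Q;
  obs_size : N * (size obs_u + 3) < size obs_Q;
  obs_sub : {subset obs_u <= S0};
  obs_commc : {in obs_Q, forall q, q * c = c * q}%g;
  obs_commg : {in obs_Q, forall q,
    q * \prod_(s <- obs_u) s = \prod_(s <- obs_u) s * q}%g;
  obs_indep : {in obs_Q &, forall q q' i j, q * c ^+ i = q' * c ^+ j -> q = q'}%g;
  obs_cut : forall s, exists B : seq G, forall x,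
    obs_f x != obs_f (x * s)%g -> x \in B;
  obs_f0 : forall i, ~~ obs_f (c ^+ i)%g;
  obs_f1 : forall i, obs_f (\prod_(s <- obs_u) s * c ^+ i)%g
}.

(** * Obstructions of all sizes exclude accessibility *)

Section Criterion.
Variables (G : groupType) (S : {fset G}) (c : G) (S0 : seq G).
Hypothesis genS : generates S.
Hypothesis cI : injective (fun i => c ^+ i)%g.
Hypothesis obsN : forall N, inhabited (obstruction c S0 N).

Section Ray.
Variables (r : nat -> G) (P : seq G).
Hypothesis rR : is_ray (cayley S) r.
Hypothesis rP : forall n, exists i, exists2 p, p \in P & r n = (c ^+ i * p)%g.

(** As [q] commutes with [c], inserting it to the left of [r n = c ^+ i * p] is right multiplication
    by the conjugate of [q] by [p]. Only finitely many conjugates occur, so the connecting paths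
    have finitely many shapes and escape every vertex. *)
Lemma ray_equiv_mulr x q : (q * c = c * q)%g ->
  ray_equiv (cayley S) (fun n => x * r n)%g (fun n => x * q * r n)%g.
Proof.
move=> qc; have /choice[D HD] := conn_mulr genS.
pose DD := flatten [seq D (p^-1 * q * p)%g | p <- P].
apply: (@ray_equiv_conn _ _ _ _ (fun n => [seq (x * r n * d)%g | d <- DD])).
  move=> n; have [i [p pP rE]] := rP n.
  have -> : (x * q * r n = x * r n * (p^-1 * q * p))%g.
    rewrite rE !mulgA mulgK; congr (_ * _)%g; rewrite -!mulgA; congr (_ * _)%g.
    by apply: commuteX.
  apply: HD => d dD; apply: map_f; apply/flatten_mapP; by exists p.
move=> y; have [|N HN] := @injective_eventually_notin _ (fun n => x * r n)%g
    [seq (y * d^-1)%g | d <- DD].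
  by case: rR => rI _ m n /mulgI /rI.
exists N => n /HN; apply: contra => /mapP[d dD ->]; apply/mapP; exists d => //.
by rewrite mulgK.
Qed.

(** For each of the finitely many offsets [p], the values of [f] at [y] and [y * p] differ at
    finitely many [y] only, and [f] is constant on the points [g * c ^+ i]. *)
Lemma eventually_constant (f : G -> bool) g :
  (forall s, exists B : seq G, forall x, f x != f (x * s)%g -> x \in B) ->
  (forall i j, f (g * c ^+ i)%g = f (g * c ^+ j)%g) ->
  exists N, forall n, N <= n -> f (g * r n)%g = f g.
Proof.
move=> /choice[B HB] fc.
pose l := flatten [seq [seq (b * p)%g | b <- B p] | p <- P].
have [|N HN] := @injective_eventually_notin _ (fun n => g * r n)%g l.
  by case: rR => rI _ m n /mulgI /rI.
exists N => n /HN; have [i [p pP ->]] := rP n => H.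
rewrite -[g in RHS]mulg1 -(expg0 c) (fc 0 i) mulgA; apply/esym/eqP.
apply: contraNT H => /HB Hb; apply/flatten_mapP; exists p => //.
by rewrite mulgA; exact: map_f.
Qed.

End Ray.

Theorem not_accessible_of_obstructions : ~ accessible (cayley S).
Proof.
move=> [k Hk]; have [r [P [rR r0 rP]]] := ray_along_powers genS cI.
have /choice[D HD] := conn_mulr genS.
(* All offsets at which the ray or a path spelling a letter can leave the points that are counted;
   [1] covers these points themselves. *)
pose Pref := 1%g :: P ++ flatten [seq D s | s <- S0].
have [[Q u f UQ szQ subu Qc Qg Qindep cutf f0 f1]] := obsN (k.*2 * size Pref).
set g := (\prod_(s <- u) s)%g in Qg f1.
pose r' n := (g * r n)%g.
have r'R : is_ray (cayley S) r' by exact: is_ray_mull.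
have rT q : q \in Q -> ray_equiv (cayley S) r (fun n => q * r n)%g.
  move=> /Qc qc; have := ray_equiv_mulr rR rP 1%g qc.
  have -> : (fun n => 1 * r n)%g = r by apply/funext => n; rewrite mul1g.
  by rewrite mul1g.
have r'T q : (q * c = c * q)%g -> ray_equiv (cayley S) r' (fun n => g * q * r n)%g.
  by move=> qc; exact: (ray_equiv_mulr rR rP g qc).
pose w := [set r0 | is_ray (cayley S) r0 /\ ray_equiv (cayley S) r r0]%classic.
pose w' := [set r0 | is_ray (cayley S) r0 /\ ray_equiv (cayley S) r' r0]%classic.
have ww' : w <> w'.
  move=> E; have : w' r'.
    split=> //.
    have E1 : (fun n => g * 1 * r n)%g = r' by apply/funext => n; rewrite mulg1.
    by rewrite -{2}E1; apply: r'T; rewrite mul1g mulg1.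
  rewrite -E => -[_]; have /choice[B HB] := cutf.
  pose BB := flatten [seq B t | t <- enum_fset S ++ [seq x^-1%g | x <- enum_fset S]].
  apply: (@not_ray_equiv _ _ f BB).
  - move=> y z /cayleyP[_ [t tS ->]] /HB yt; apply/flatten_mapP; exists t => //.
    rewrite mem_cat; case/orP: tS => [-> //|tS].
    by rewrite -[t in X in _ || X]invgK map_f ?orbT.
  - have fc i j : f (1 * c ^+ i)%g = f (1 * c ^+ j)%g.
      by rewrite !mul1g (negPf (f0 i)) (negPf (f0 j)).
    have [N HN] := eventually_constant rR rP cutf fc; exists N => n /HN.
    by rewrite mul1g => ->; rewrite -(expg0 c).
  - have fc i j : f (g * c ^+ i)%g = f (g * c ^+ j)%g by rewrite !f1.
    have [N HN] := eventually_constant rR rP cutf fc; exists N => n /HN ->.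
    by rewrite -[g]mulg1 -(expg0 c).
have [||F [_ Fk sepF]] := Hk w w' _ _ ww'; [by exists r|by exists r'|].
pose Bad := [seq e.1 | e <- enum_fset F] ++ [seq e.2 | e <- enum_fset F].
have szBad : size Bad <= k.*2 by rewrite size_cat !size_map -addnn leq_add.
pose U x := x \notin Bad.
have [q qQ [Uqr Uqg Uqu]] : exists2 q, q \in Q & [/\ forall n, U (q * r n)%g,
    forall n, U (q * g * r n)%g &
    forall v p, v \in prefixes u -> p \in Pref -> U (q * v * p)%g].
  apply: contrapT => nex.
  (* If every [q] failed, each would have some [q * c ^+ i] in one of three lists: [K1] for the ray
     at [q], [K2] for the ray at [q * g], moved by the commutation of [q] with [g], and [K3] for the
     path between them. Their sizes explain the factor [size u + 3]; the factor [k.*2] counts the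
     ends of deleted edges. *)
  pose K1 := [seq (x * p^-1)%g | x <- Bad, p <- Pref].
  pose K2 := [seq (g^-1 * y)%g | y <- K1].
  pose K3 := [seq (y * v^-1)%g | y <- K1, v <- prefixes u].
  suff : size Q <= size (K1 ++ K2 ++ K3).
    rewrite leqNgt => /negP; apply; apply: leq_ltn_trans szQ.
    rewrite !size_cat size_map !size_allpairs size_prefixes.
    have -> : size Bad * size Pref +
        (size Bad * size Pref + size Bad * size Pref * (size u).+1) =
        size Bad * size Pref * (size u + 3) by lia.
    by rewrite leq_mul2r leq_mul2r szBad !orbT.
  apply: (@size_le_of_rel _ _ _ _ (fun q y => exists i, q * c ^+ i = y)%g) => //.
    move=> q qQ; apply: contrapT => nK; apply: nex; exists q => //.
    have K1P x p : x \in Bad -> p \in Pref -> (x * p^-1)%g \in K1.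
      by move=> xB pP; exact: allpairs_f.
    have PP p : p \in P -> p \in Pref by rewrite inE mem_cat => ->; rewrite orbT.
    split=> [n|n|v p vu pP]; apply/negP => bad; apply: nK.
    - have [i [p pP rE]] := rP n; exists (q * c ^+ i)%g; last by exists i.
      by rewrite mem_cat -[(q * _)%g](mulgK p) K1P ?PP // -mulgA -rE.
    - have [i [p pP rE]] := rP n; exists (q * c ^+ i)%g; last by exists i.
      rewrite !mem_cat; apply/orP; right; apply/orP; left.
      apply/mapP; exists (g * (q * c ^+ i))%g; last by rewrite mulKg.
      rewrite -[(g * _)%g](mulgK p) K1P ?PP //.
      by move: bad; rewrite rE Qg // !mulgA.
    - exists q; last by exists 0; rewrite expg0 mulg1.
      rewrite !mem_cat; apply/orP; right; apply/orP; right.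
      rewrite -{1}[q](mulgK v) [(q * v)%g in X in (X * _)%g](_ : _ = q * v * p * p^-1)%g.
        by apply: allpairs_f => //; exact: K1P.
      by rewrite mulgK.
  by move=> a a' aQ a'Q y [i <-] [j E]; apply: (Qindep _ _ aQ a'Q i j); rewrite E.
have conn_u v x : {subset v <= S0} ->
    (forall y p, y \in prefixes v -> p \in Pref -> U (x * y * p)%g) ->
    conn (cayley S) U x (x * \prod_(s <- v) s)%g.
  have P1 s p : s \in S0 -> p \in D s -> p \in Pref.
    by move=> sS0 ps; rewrite inE mem_cat; apply/orP; right; apply/orP; right;
      apply/flatten_mapP; exists s.
  elim: v x => [|s v IH] x vS0 /= H.
    rewrite big_nil mulg1; apply: conn_refl.
    by rewrite -[x]mulg1 -[(x * 1)%g]mulg1; apply: H; exact: mem_head.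
  rewrite big_cons mulgA; apply: (@conn_trans _ _ _ (x * s)%g).
    apply: HD => p pD; rewrite -[x]mulg1; apply: H; first exact: mem_head.
    by apply: P1 pD; apply: vS0; exact: mem_head.
  apply: IH => [a av|y p yv pP]; first by apply: vS0; rewrite inE av orbT.
  by rewrite -[(x * s * y)%g]mulgA; apply: H => //; rewrite inE map_f ?orbT.
(* The rays at [q] and [g * q] represent the two ends, and together with the path from [q] to
   [q * g] they avoid every deleted edge. *)
have [N HN] := sepF _ _ (conj (is_ray_mull q rR) (rT q qQ))
  (conj (is_ray_mull (g * q)%g rR) (r'T q (Qc q qQ))).
apply: (HN N N (leqnn _) (leqnn _)).
apply: (@conn_joined _ _ U).
  by move=> e eF; rewrite /U mem_cat map_f.
apply: (@conn_trans _ _ _ q).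
  have := @conn_ray _ (cayley S) U (fun n => q * r n)%g N.
  by rewrite r0 mulg1 => H; apply: conn_sym; apply: H => //; exact: is_ray_mull.
apply: (@conn_trans _ _ _ (q * g)%g); first exact: conn_u.
have := @conn_ray _ (cayley S) U (fun n => q * g * r n)%g N.
rewrite r0 mulg1 -Qg //; apply=> //; exact: is_ray_mull.
Qed.

End Criterion.

(** * The group *)

(* Each of the generators z, q, t, c comes with a formal inverse. *)
Definition letter : Type := (bool * bool * bool)%type.
Notation word := (seq letter).
HB.instance Definition _ := Countable.on letter.

Definition gen_z : letter := (false, false, false).
Definition gen_q : letter := (false, true, false).
Definition gen_t : letter := (true, false, false).
Definition gen_c : letter := (true, true, false).
Definition linv (s : letter) : letter := (s.1, ~~ s.2).
Definition winv (w : word) : word := rev (map linv w).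
Definition wcomm (u v : word) : word := u ++ v ++ winv u ++ winv v.

Definition wq (i : nat) : word := nseq i gen_t ++ gen_q :: nseq i (linv gen_t).

(* The commutator of [wz m] and [wq m.*2], which are both involutions. The index
   [m.*2] makes the 4 ^ m products of the [wq i] commuting with [wz m] outnumber
   the letters of [wz m]. *)
Fixpoint wz (n : nat) : word :=
  if n is m.+1 then wz m ++ wq m.*2 ++ wz m ++ wq m.*2 else [:: gen_z].

Inductive relator : word -> Prop :=
| rel_inv s : relator [:: s; linv s]
| rel_q : relator [:: gen_q; gen_q]
| rel_z n : relator (wz n ++ wz n)
| rel_cq : relator (wcomm [:: gen_c] [:: gen_q])
| rel_ct : relator (wcomm [:: gen_c] [:: gen_t])
| rel_qq i j : relator (wcomm (wq i) (wq j))
| rel_zq n i : i < n.*2 -> relator (wcomm (wz n) (wq i)).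

Definition model (X : Type) (act : letter -> X -> X) (bs : seq (X -> bool)) :=
  binary act bs /\ forall r, relator r -> forall x, agree bs (run act x r) x.

(* Equality in the largest residually binary group satisfying the relators. *)
Definition weq (u v : word) : bool :=
  `[< forall X (act : letter -> X -> X) bs, model act bs ->
      forall x, agree bs (run act x u) (run act x v) >].

Lemma weq_refl : reflexive weq.
Proof. by move=> u; apply/asboolP => *; exact: agreexx. Qed.

Lemma weq_sym : symmetric weq.
Proof.
suff H u v : weq u v -> weq v u by move=> u v; apply/idP/idP; exact: H.
by move=> /asboolP H; apply/asboolP => *; rewrite agree_sym; exact: H.
Qed.

Lemma weq_trans : transitive weq.
Proof.
move=> v u w /asboolP uv /asboolP vw; apply/asboolP => X act bs M x.
exact: agree_trans (uv _ _ _ M x) (vw _ _ _ M x).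
Qed.

Canonical weq_equiv := EquivRel weq weq_refl weq_sym weq_trans.

Lemma weq_cat u u' v v' : weq u u' -> weq v v' -> weq (u ++ v) (u' ++ v').
Proof.
move=> /asboolP uu /asboolP vv; apply/asboolP => X act bs M x; rewrite !run_cat.
apply: agree_trans (binary_run _ _ (uu _ _ _ M x)) (vv _ _ _ M _).
by case: M.
Qed.

Lemma linvK : involutive linv.
Proof. by move=> [s b]; rewrite /linv negbK. Qed.

Lemma winvK : involutive winv.
Proof. by move=> w; rewrite /winv map_rev revK mapK //; exact: linvK. Qed.

Lemma relator_weq r : relator r -> weq r [::].
Proof. by move=> Rr; apply/asboolP => X act bs [_ H] x; exact: H. Qed.

Lemma weq_catV w : weq (w ++ winv w) [::].
Proof.
elim: w => [|s w IH]; first exact: weq_refl.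
have -> : (s :: w) ++ winv (s :: w) = [:: s] ++ (w ++ winv w) ++ [:: linv s].
  by rewrite /winv map_cons rev_cons -cats1 catA.
apply: (@weq_trans ([:: s] ++ [::] ++ [:: linv s])).
  by do !apply: weq_cat => //; exact: weq_refl.
exact/relator_weq/rel_inv.
Qed.

Definition gam : Type := {eq_quot weq_equiv}%qT.
HB.instance Definition _ := Choice.on gam.

Definition el (w : word) : gam := (\pi_{eq_quot weq_equiv} w)%qT.
Definition rep (x : gam) : word := repr (x : {eq_quot weq_equiv}%qT).

Lemma repK : cancel rep el.
Proof. by move=> x; rewrite /el /rep reprK. Qed.

Lemma elE u v : (el u = el v) <-> weq u v.
Proof. by split=> [/eqquotP|H]; [|apply/eqquotP]. Qed.

Lemma weq_rep w : weq (rep (el w)) w.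
Proof. by apply/elE; rewrite repK. Qed.

Definition gam_mul (x y : gam) := el (rep x ++ rep y).
Definition gam_inv (x : gam) := el (winv (rep x)).

Lemma gam_mul_el u v : gam_mul (el u) (el v) = el (u ++ v).
Proof. by apply/elE/weq_cat; exact: weq_rep. Qed.

Lemma gam_mulA : associative gam_mul.
Proof.
by move=> x y z; rewrite -[x]repK -[y]repK -[z]repK !gam_mul_el catA.
Qed.

Lemma gam_mul1g : left_id (el [::]) gam_mul.
Proof. by move=> x; rewrite -[x]repK gam_mul_el. Qed.

Lemma gam_mulg1 : right_id (el [::]) gam_mul.
Proof. by move=> x; rewrite -[x]repK gam_mul_el cats0. Qed.

Lemma gam_mulVg : left_inverse (el [::]) gam_inv gam_mul.
Proof.
move=> x; rewrite /gam_inv -{2}[x]repK gam_mul_el; apply/elE.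
by rewrite -{2}[rep x]winvK; exact: weq_catV.
Qed.

Lemma gam_mulgV : right_inverse (el [::]) gam_inv gam_mul.
Proof.
by move=> x; rewrite /gam_inv -{1}[x]repK gam_mul_el; apply/elE/weq_catV.
Qed.

HB.instance Definition _ := isGroup.Build gam
  gam_mulA gam_mul1g gam_mulg1 gam_mulVg gam_mulgV.

Lemma el_nil : el [::] = 1%g. Proof. by []. Qed.

Lemma el_cat u v : el (u ++ v) = (el u * el v)%g.
Proof. by rewrite -gam_mul_el. Qed.

Lemma el_cons s w : el (s :: w) = (el [:: s] * el w)%g.
Proof. exact: (el_cat [:: s]). Qed.

Lemma el_relator r : relator r -> el r = 1%g.
Proof. by move=> Rr; apply/elE; exact: relator_weq. Qed.

Lemma el_winv w : el (winv w) = (el w)^-1%g.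
Proof.
apply: (mulgI (el w)); rewrite mulgV -el_cat; apply/elE; exact: weq_catV.
Qed.

Lemma el_linv s : el [:: linv s] = (el [:: s])^-1%g.
Proof. exact: (el_winv [:: s]). Qed.

Lemma model_agree X (act : letter -> X -> X) bs u v x :
  model act bs -> el u = el v -> agree bs (run act x u) (run act x v).
Proof. by move=> M /elE/asboolP; apply. Qed.

(** Distinct elements are told apart in some model at some point [x0]; its chain is pulled back
    along the orbit map of [x0]. *)
Lemma gam_residually_binary : residually_binary gam.
Proof.
move=> x y xy.
have nW : ~ weq (rep x) (rep y) by move/elE; rewrite !repK.
have [X [act [bs [M [x0 nA]]]]] : exists X (act : letter -> X -> X) bs,
    model act bs /\ exists x0, ~~ agree bs (run act x0 (rep x)) (run act x0 (rep y)).
  apply: contrapT => H; apply: nW; apply/asboolP => X act bs M x0.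
  by apply: contrapT => /negP nA; apply: H; exists X, act, bs; split=> //; exists x0.
pose f (g : gam) := run act x0 (rep g).
exists [seq b \o f | b <- bs]; last by rewrite agree_map.
case: (M) => Bbs _; apply: binary_pullback Bbs _ => g; exists (rep g) => h.
by rewrite -run_cat; apply: model_agree => //; rewrite repK el_cat !repK.
Qed.

(** Pairs of words are countable, so a sequence of chains, one for each pair, separates all
    elements; indices that need no separation get the empty chain. *)
Lemma gam_uniform_tww : uniform_tww gam <> None.
Proof.
have /choice[e He] : forall n : nat, exists bs, binary (@rmulg gam) bs /\
    forall u v : word, choice.unpickle n = Some (u, v) -> el u <> el v ->
    ~~ agree bs (el u) (el v).
  move=> n; case: (choice.unpickle n : option (word * word)) => [[u v]|]; last first.
    by exists [::].
  case: (pselect (el u = el v)) => [uv|/gam_residually_binary[bs Bbs Hbs]].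
    by exists [::]; split=> // _ _ [<- <-].
  by exists bs; split=> // _ _ [<- <-].
apply: (@uniform_tww_finite _ e) => [n|x y Hxy]; first by case: (He n).
apply: contrapT => xy; have [_ /(_ (rep x) (rep y))] := He (choice.pickle (rep x, rep y)).
by rewrite choice.pickleK !repK Hxy => /(_ erefl xy).
Qed.

Definition gam_gens : {fset gam} :=
  [fset el [:: gen_z]; el [:: gen_q]; el [:: gen_t]; el [:: gen_c]]%fset.

Lemma gam_finitely_generated : finitely_generated gam.
Proof.
exists gam_gens => g; exists [seq el [:: s] | s <- rep g]; split.
  apply/allP => _ /mapP[s _ ->]; rewrite -el_linv.
  by case: s => [[[] []] []]; rewrite /linv /= !inE ?eqxx ?orbT.
rewrite big_map -{1}[g]repK; elim: (rep g) => [|s w IH]; first by rewrite big_nil.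
by rewrite big_cons -IH el_cons.
Qed.

(** * A lamplighter model *)

Section Digits.
Variables (I X : Type) (act : I -> X -> X) (K : nat) (f : X -> 'I_(2 ^ K)).
Hypothesis fact : forall s, exists2 d, forall x, f (act s x) = d (f x) &
  [\/ d = id, d = @ordS (2 ^ K) | d = @ord_pred (2 ^ K)].

Fixpoint digits k : seq (X -> bool) :=
  if k is k'.+1 then (fun x => odd (f x %/ 2 ^ k')) :: digits k' else [::].

Lemma eqn_mod_exp2S k (a b : nat) :
  (a == b %[mod 2 ^ k.+1]) =
  (odd (a %/ 2 ^ k) == odd (b %/ 2 ^ k)) && (a == b %[mod 2 ^ k]).
Proof.
have modS (x : nat) : x %% 2 ^ k.+1 = odd (x %/ 2 ^ k) * 2 ^ k + x %% 2 ^ k.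
  have E : x = (x %/ 2 ^ k)./2 * 2 ^ k.+1 + (odd (x %/ 2 ^ k) * 2 ^ k + x %% 2 ^ k).
    rewrite {1}(divn_eq x (2 ^ k)) -{1}[x %/ 2 ^ k]odd_double_half mulnDl expnS.
    by rewrite -muln2; nia.
  rewrite {1}E modnMDl modn_small //.
  have : x %% 2 ^ k < 2 ^ k by rewrite ltn_mod expn_gt0.
  by rewrite expnS; case: (odd _) => /=; lia.
rewrite !modS; have [la lb] : a %% 2 ^ k < 2 ^ k /\ b %% 2 ^ k < 2 ^ k.
  by rewrite !ltn_mod !expn_gt0.
by case: (odd (a %/ _)); case: (odd (b %/ _)) => /=; lia.
Qed.

Lemma agree_digits k x y : agree (digits k) x y = (f x == f y %[mod 2 ^ k]).
Proof.
elim: k => [|k IH]; first by rewrite expn0 !modn1.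
by rewrite eqn_mod_exp2S -IH.
Qed.

(** Agreement on the low digits is congruence modulo a power of two dividing [2 ^ K], which the
    cyclic successor and predecessor preserve. *)
Lemma binary_digits k : k <= K -> binary act (digits k).
Proof.
elim: k => //= k IH kK; split; first by apply: IH; exact: ltnW.
move=> s x y; rewrite agree_digits => E bE.
have {E bE} : f x == f y %[mod 2 ^ k.+1] by rewrite eqn_mod_exp2S bE eqxx.
suff H : f x == f y %[mod 2 ^ k.+1] -> f (act s x) == f (act s y) %[mod 2 ^ k.+1].
  by move/H; rewrite eqn_mod_exp2S => /andP[/eqP].
have dv : 2 ^ k.+1 %| 2 ^ K by rewrite dvdn_Pexp2l.
have [d Hd dE] := fact s; rewrite !Hd; case: dE => -> //=.
  rewrite !(modn_dvdm _ dv) -[(f x).+1]addn1 -[(f y).+1]addn1 => /eqP E.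
  by apply/eqP; rewrite -modnDml E modnDml.
(* [ord_pred] adds [2 ^ K] before subtracting one, so the subtraction is never truncated. *)
have predE (a : nat) : (a + 2 ^ K).-1 = a + (2 ^ K).-1.
  by have : 0 < 2 ^ K; [rewrite expn_gt0|lia].
rewrite !(modn_dvdm _ dv) !predE => /eqP E.
by apply/eqP; rewrite -modnDml E modnDml.
Qed.

End Digits.

Section Model.
Variables (K n : nat).
Hypothesis nK : n.*2 <= 2 ^ K.

Local Notation pos := 'I_(2 ^ K).
Local Notation lamps := {ffun pos -> bool}.
Definition mstate : Type := (pos * pos * lamps * bool)%type.

Definition shift i (p : pos) : pos := iter i (@ordS _) p.

Definition toggle (A : lamps) (p : pos) : lamps := [ffun j => A j (+) (j == p)].

(** The condition under which [wz m] flips the last bit ([mrun_wz]). It always holds for [m = n] and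
    always fails for [m > n]. *)
Definition zcond m (p : pos) (A : lamps) :=
  (m <= n) && all (fun i => ~~ A (shift i.*2 p)) (iota m (n - m)).

(* [c] moves a counter, [t] moves a lamplighter, [q] switches the lamp at the
   current position, and [z] flips the last bit if the lamps at distances 0, 2,
   ..., 2(n - 1) are off. *)
Definition mact (s : letter) (x : mstate) : mstate :=
  let: (r, p, A, e) := x in
  match s with
  | (false, false, _) => (r, p, A, e (+) zcond 0 p A)
  | (false, true, _) => (r, p, toggle A p, e)
  | (true, false, b) => (r, if b then ord_pred p else ordS p, A, e)
  | (true, true, b) => (if b then ord_pred r else ordS r, p, A, e)
  end.

(** Finest first: the flip depends on lamps and position, a lamp change on the position, while the
    position and the counter each move on their own. *)
Definition mbits : seq (mstate -> bool) :=
  (fun x => x.2) :: [seq (fun x : mstate => x.1.2 j) | j <- enum 'I_(2 ^ K)] ++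
  digits (fun x : mstate => x.1.1.2) K ++ digits (fun x : mstate => x.1.1.1) K.

Lemma agree_mbits_tail x y :
  agree (behead mbits) x y -> x.1 = y.1.
Proof.
case: x y => [[[r p] A] e] [[[r' p'] A'] e'].
rewrite /= !agree_cat !agree_digits /= !modn_small // => /and3P[HA /eqP Hp /eqP Hr].
congr (_, _, _); [exact: val_inj|exact: val_inj|].
apply/ffunP => j; move: HA; rewrite /agree all_map => /allP /(_ j) /=.
by rewrite mem_enum => /(_ isT) /eqP.
Qed.

Lemma agree_mbits x y : agree mbits x y -> x = y.
Proof.
rewrite /agree /mbits => /= /andP[/eqP E /agree_mbits_tail].
by case: x y E => [a b] [a' b'] /= -> ->.
Qed.

Lemma binary_mbits : binary mact mbits.
Proof.
have Br : binary mact (digits (fun x : mstate => x.1.1.1) K).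
  apply: binary_digits => // -[[[] []] b].
  - exists (if b then @ord_pred (2 ^ K) else @ordS (2 ^ K)).
      by move=> [[[r p] A] e]; case: b.
    by case: b; [constructor 3|constructor 2].
  - by exists id => [[[[r p] A] e]|] //; constructor 1.
  - by exists id => [[[[r p] A] e]|] //; constructor 1.
  - by exists id => [[[[r p] A] e]|] //; constructor 1.
have Bp : binary mact (digits (fun x : mstate => x.1.1.2) K).
  apply: binary_digits => // -[[[] []] b].
  - by exists id => [[[[r p] A] e]|] //; constructor 1.
  - exists (if b then @ord_pred (2 ^ K) else @ordS (2 ^ K)).
      by move=> [[[r p] A] e]; case: b.
    by case: b; [constructor 3|constructor 2].
  - by exists id => [[[[r p] A] e]|] //; constructor 1.
  - by exists id => [[[[r p] A] e]|] //; constructor 1.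
have Bl : binary mact (behead mbits).
  rewrite /=; elim: (enum _) => [|j js IH] /=; first exact: binary_cat.
  split=> // s x y; rewrite !agree_cat => /and3P[_ + _].
  rewrite agree_digits !modn_small // => /eqP/val_inj.
  case: x y => [[[r p] A] e] [[[r' p'] A'] e'] /= <- Aj.
  by case: s => [[[] []] []] //=; rewrite !ffunE Aj.
split=> // s x y /agree_mbits_tail; case: x y => [[[r p] A] e] [[[r' p'] A'] e'] /=.
by case=> _ <- <- <-; case: s => [[[] []] []].
Qed.

Notation mrun := (run mact).

Lemma mact_linv s x : mact (linv s) (mact s x) = x.
Proof.
case: x => [[[r p] A] e]; case: s => [[[] []] []] /=; rewrite ?ordSK ?ord_predK //.
all: try by rewrite addbK.
all: congr (_, _, _, _); apply/ffunP => j; rewrite !ffunE addbK //.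
Qed.

Lemma mrun_winv w x : mrun (mrun x w) (winv w) = x.
Proof.
elim: w x => //= s w IH x.
by rewrite /winv map_cons rev_cons -cats1 run_cat IH /= mact_linv.
Qed.

Lemma mrun_wcomm u v x :
  (forall y, mrun (mrun y u) v = mrun (mrun y v) u) -> mrun x (wcomm u v) = x.
Proof. by move=> uv; rewrite /wcomm !run_cat uv !mrun_winv. Qed.

Lemma mrun_wq i r p A e :
  mrun (r, p, A, e) (wq i) = (r, p, toggle A (shift i p), e).
Proof.
have H1 j : mrun (r, p, A, e) (nseq j gen_t) = (r, shift j p, A, e).
  by elim: j p => //= j IH p; rewrite IH /shift -iterSr.
have H2 j B : mrun (r, shift j p, B, e) (nseq j (linv gen_t)) = (r, p, B, e).
  by elim: j => //= j IH; rewrite /shift /= ordSK.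
by rewrite /wq run_cat H1 /= H2.
Qed.

Lemma val_shift i p : val (shift i p) = (p + i) %% 2 ^ K.
Proof.
elim: i => [|i IH]; first by rewrite addn0 modn_small.
by rewrite /shift /= IH -addn1 modnDml addn1 addnS.
Qed.

Lemma shift_inj i j p : i < 2 ^ K -> j < 2 ^ K -> (shift i p == shift j p) = (i == j).
Proof.
by move=> iK jK; rewrite -val_eqE !val_shift eqn_modDl !modn_small.
Qed.

Lemma toggleK A p : toggle (toggle A p) p = A.
Proof. by apply/ffunP => j; rewrite !ffunE addbK. Qed.

Lemma toggleC A p p' : toggle (toggle A p) p' = toggle (toggle A p') p.
Proof. by apply/ffunP => j; rewrite !ffunE addbAC. Qed.

(** The inspected lamps are at distances at least [m.*2]; by [nK] no distance involved wraps around
    the cycle. *)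
Lemma zcond_toggle m i p A : i < m.*2 -> zcond m p (toggle A (shift i p)) = zcond m p A.
Proof.
move=> im; rewrite /zcond; case: leqP => //= mn; apply: eq_in_all => j.
rewrite mem_iota => /andP[mj jn]; rewrite ffunE shift_inj; [|lia|lia].
by rewrite (_ : (_ == _) = false) ?addbF //; apply/eqP; lia.
Qed.

(** The commutator flips the bit exactly when toggling lamp [m.*2] changes the condition, that is,
    when all the later inspected lamps are off. *)
Lemma zcondS m p A :
  zcond m p A (+) zcond m p (toggle A (shift m.*2 p)) = zcond m.+1 p A.
Proof.
have [mn|nm] := ltnP m n.
  have E B : zcond m p B = ~~ B (shift m.*2 p) && zcond m.+1 p B.
    by rewrite /zcond mn (ltnW mn) /= -{1}(subnSK mn).
  rewrite (E A) (E (toggle _ _)) zcond_toggle; last by lia.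
  by rewrite ffunE eqxx addbT; case: (A _); case: (zcond _ _ _).
(* For [m = n] both conditions hold and cancel; for [m > n] both fail. *)
rewrite /zcond [_.+1 <= n]ltnNge nm /=.
move: nm; rewrite leq_eqVlt => /orP[/eqP->|]; first by rewrite leqnn subnn.
by rewrite ltnNge => /negPf->.
Qed.

Lemma mrun_wz m r p A e :
  mrun (r, p, A, e) (wz m) = (r, p, A, e (+) zcond m p A).
Proof.
elim: m e A => // m IH e A.
have -> : wz m.+1 = wz m ++ wq m.*2 ++ wz m ++ wq m.*2 by [].
rewrite (run_cat _ _ (wz m)) (run_cat _ _ (wq _)) (run_cat _ _ (wz m)).
by rewrite IH mrun_wq IH mrun_wq toggleK -addbA zcondS.
Qed.

Lemma mrun_relator r x : relator r -> mrun x r = x.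
Proof.
case=> [s||m|||i j|m i im].
- exact: mact_linv.
- by case: x => [[[? ?] ?] ?] /=; rewrite toggleK.
- by case: x => [[[? ?] ?] ?]; rewrite run_cat !mrun_wz addbK.
- by apply: mrun_wcomm => -[[[? ?] ?] ?].
- by apply: mrun_wcomm => -[[[? ?] ?] ?].
- by apply: mrun_wcomm => -[[[? ?] ?] ?]; rewrite !mrun_wq toggleC.
- by apply: mrun_wcomm => -[[[? ?] ?] ?]; rewrite !(mrun_wq, mrun_wz) zcond_toggle.
Qed.

Lemma mrun_el u v x : el u = el v -> mrun x u = mrun x v.
Proof.
move=> uv; apply: agree_mbits; apply: model_agree uv; split.
  exact: binary_mbits.
by move=> r Rr y; rewrite mrun_relator // agreexx.
Qed.

Definition o0 : pos := Ordinal (expn_gt0 2 K : 0 < 2 ^ K).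

Definition mstate_of (x : gam) : mstate :=
  mrun (o0, o0, [ffun => false], false) (rep x).

Lemma mstate_of_el w : mstate_of (el w) = mrun (o0, o0, [ffun => false], false) w.
Proof. by apply: mrun_el; rewrite repK. Qed.

Lemma mstate_of_mul x w : mstate_of (x * el w)%g = mrun (mstate_of x) w.
Proof. by rewrite -{1}[x]repK -el_cat mstate_of_el run_cat. Qed.

End Model.

(** * Relations among the named elements, and the subgroup generated by the first [q_ i] *)

Lemma el_comm u v : relator (wcomm u v) -> (el u * el v = el v * el u)%g.
Proof.
move/el_relator; rewrite /wcomm !el_cat !el_winv !mulgA.
move/(congr1 (fun x => x * el v * el u)%g).
by rewrite !mulgVK mul1g.
Qed.

Definition q_ i := el (wq i).
Definition z_ m := el (wz m).
Definition c_ : gam := el [:: gen_c].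

Lemma q_qC i j : (q_ i * q_ j = q_ j * q_ i)%g.
Proof. exact/el_comm/rel_qq. Qed.

Lemma z_qC m i : i < m.*2 -> (z_ m * q_ i = q_ i * z_ m)%g.
Proof. by move=> im; exact/el_comm/rel_zq. Qed.

Lemma z_sqr m : (z_ m * z_ m = 1)%g.
Proof. by rewrite /z_ -el_cat el_relator //; exact: rel_z. Qed.

Lemma z_S m : z_ m.+1 = (z_ m * q_ m.*2 * z_ m * q_ m.*2)%g.
Proof. by rewrite /z_ [LHS]el_cat (el_cat (wq _)) (el_cat (wz m)) !mulgA. Qed.

Lemma el_nseq i s : el (nseq i s) = (el [:: s] ^+ i)%g.
Proof.
elim: i => [|i IH]; first by rewrite expg0 el_nil.
by rewrite /= el_cons IH expgS.
Qed.

Lemma q_E i : q_ i = (el [:: gen_t] ^+ i * el [:: gen_q] * el [:: gen_t] ^- i)%g.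
Proof.
by rewrite /q_ el_cat el_cons !el_nseq el_linv expVgn mulgA.
Qed.

Lemma q_sqr i : (q_ i * q_ i = 1)%g.
Proof.
have E : (el [:: gen_q] * el [:: gen_q] = 1)%g.
  by rewrite -el_cat el_relator //; exact: rel_q.
rewrite q_E -!mulgA mulKg [X in (_ * X)%g]mulgA E mul1g.
exact: mulgV.
Qed.

Lemma c_qC i : (q_ i * c_ = c_ * q_ i)%g.
Proof.
have ct : commute c_ (el [:: gen_t]) by exact/el_comm/rel_ct.
have cq : commute c_ (el [:: gen_q]) by exact/el_comm/rel_cq.
apply/commute_sym; rewrite q_E; apply: commuteM; last exact/commuteV/commuteX.
by apply: commuteM => //; exact: commuteX.
Qed.

(** The subset products of the first [m] commuting involutions [q_ i], which form the subgroup they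
    generate; [uniq_Qs] shows that there are no repetitions. *)
Fixpoint Qs m : seq gam :=
  if m is k.+1 then Qs k ++ [seq (x * q_ k)%g | x <- Qs k] else [:: 1%g].

Lemma size_Qs m : size (Qs m) = 2 ^ m.
Proof. by elim: m => //= m IH; rewrite size_cat size_map IH expnS mul2n addnn. Qed.

Lemma mem1_Qs m : 1%g \in Qs m.
Proof. by elim: m => [|m IH] /=; rewrite ?mem_head // mem_cat IH. Qed.

Lemma Qs_ind (P : gam -> Prop) m :
  P 1%g -> (forall x i, i < m -> P x -> P (x * q_ i)%g) -> {in Qs m, forall x, P x}.
Proof.
move=> P1; elim: m => [|m IH] PM x /=; first by rewrite inE => /eqP->.
have {}IH : {in Qs m, forall x, P x}.
  by apply: IH => y i im; apply: PM; exact: ltnW.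
by rewrite mem_cat => /orP[/IH//|/mapP[y /IH Py ->]]; apply: PM.
Qed.

Lemma Qs_mulr m i x : i < m -> x \in Qs m -> (x * q_ i)%g \in Qs m.
Proof.
elim: m x => //= m IH x; rewrite ltnS leq_eqVlt mem_cat => im.
case/orP: im => [/eqP->|im] /orP[xm|/mapP[y ym ->]]; rewrite mem_cat.
- by rewrite (map_f (fun x => x * q_ m)%g xm) orbT.
- by rewrite -mulgA q_sqr mulg1 ym.
- by rewrite IH.
- by rewrite -mulgA q_qC mulgA (map_f (fun x => x * q_ m)%g) ?orbT // IH.
Qed.

Lemma Qs_comm m g : (forall i, i < m -> (g * q_ i = q_ i * g)%g) ->
  {in Qs m, forall x, (x * g = g * x)%g}.
Proof.
move=> H; apply: Qs_ind => [|x i im xg]; first by rewrite mulg1 mul1g.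
by rewrite -mulgA -H // mulgA xg mulgA.
Qed.

(** * Lamp configurations as invariants of group elements *)

Section Lamps.
Variables (K : nat).
Local Notation st := (@mstate_of K 0).

(** The model with [n = 0] leaves [K] free, to be taken as large as the indices at hand require. *)
Definition lamp (x : gam) (i : nat) : bool := (st x).1.2 (shift i (o0 K)).

Lemma lamp1 i : lamp 1%g i = false.
Proof. by rewrite /lamp -el_nil mstate_of_el // ffunE. Qed.

Lemma lamp_mulc x k i : lamp (x * c_ ^+ k)%g i = lamp x i.
Proof.
rewrite /lamp -el_nseq mstate_of_mul //; elim: k (st x) => //= k IH y.
by rewrite IH; case: y => [[[? ?] ?] ?].
Qed.

Lemma lamp_mulz x m i : lamp (x * z_ m)%g i = lamp x i.
Proof.
rewrite /lamp mstate_of_mul //; case: (st x) => [[[? ?] ?] ?].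
by rewrite mrun_wz.
Qed.

Lemma pos_Qs m : {in Qs m, forall x, (st x).1.1.2 = o0 K}.
Proof.
apply: Qs_ind => [|x i _]; first by rewrite -el_nil mstate_of_el.
by rewrite mstate_of_mul //; case: (st x) => [[[? ?] ?] ?]; rewrite mrun_wq.
Qed.

Lemma lamp_mulq m x i j : x \in Qs m -> i < 2 ^ K -> j < 2 ^ K ->
  lamp (x * q_ i)%g j = lamp x j (+) (j == i).
Proof.
move=> /pos_Qs; rewrite /lamp mstate_of_mul //.
case: (st x) => [[[r p] A] e] /= -> iK jK; rewrite mrun_wq /= ffunE.
by rewrite shift_inj.
Qed.

Lemma lamp_out m i : m <= i -> i < 2 ^ K -> {in Qs m, forall x, lamp x i = false}.
Proof.
elim: m => [|m IH] mi iK x /=; first by rewrite inE => /eqP->; rewrite lamp1.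
rewrite mem_cat => /orP[|/mapP[y ym ->]]; first exact/IH/iK/ltnW.
by rewrite (lamp_mulq ym) ?(IH (ltnW mi)) ?gtn_eqF //; exact: ltn_trans iK.
Qed.

Lemma lamp_inj m : m <= 2 ^ K ->
  {in Qs m &, forall x y, (forall i, i < m -> lamp x i = lamp y i) -> x = y}.
Proof.
elim: m => [|m IH] mK x y /=; first by rewrite !inE => /eqP-> /eqP->.
have out := lamp_out (leqnn m) mK; have {}IH := IH (ltnW mK).
have mulqE z i : z \in Qs m -> i < m.+1 -> lamp (z * q_ m)%g i = lamp z i (+) (i == m).
  by move=> zm im; apply: lamp_mulq zm _ _ => //; apply: leq_trans im mK.
rewrite !mem_cat => /orP[xm|/mapP[x' xm ->]] /orP[ym|/mapP[y' ym ->]] H.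
- by apply: IH => // i im; apply: H; exact: ltnW.
- by have := H m (ltnSn m); rewrite mulqE // !out // eqxx.
- by have := H m (ltnSn m); rewrite mulqE // !out // eqxx.
- congr (_ * _)%g; apply: IH => // i im; have := H i (ltnW im).
  by rewrite !mulqE 1?ltnW // ltn_eqF // !addbF.
Qed.

Lemma uniq_Qs m : m <= 2 ^ K -> uniq (Qs m).
Proof.
elim: m => //= m IH mK; rewrite cat_uniq (map_inj_uniq (mulIg _)) IH ?(ltnW mK) //=.
rewrite andbT; apply/hasPn => _ /mapP[x xm ->]; apply/negP.
move/(lamp_out (leqnn m) mK); rewrite (lamp_mulq xm) // eqxx addbT.
by rewrite (lamp_out (leqnn m) mK).
Qed.

End Lamps.

Lemma ltn_exp2 m : m <= 2 ^ m. Proof. exact/ltnW/ltn_expl. Qed.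

(** Powers of [c_] leave the lamps alone, and the lamps determine an element of [Qs m]. *)
Lemma Qs_c_indep m : {in Qs m &, forall x y i j,
  (x * c_ ^+ i = y * c_ ^+ j)%g -> x = y}.
Proof.
move=> x y xm ym i j E; apply: (lamp_inj (ltn_exp2 m)) => // k _.
by rewrite -(lamp_mulc _ x i) E lamp_mulc.
Qed.

Lemma c_inj : injective (fun i => c_ ^+ i)%g.
Proof.
(* With this [K] both exponents are below [2 ^ K], so the cyclic counter tells them apart. *)
move=> i j /= E; pose K := maxn i j.
have [iK jK] : i < 2 ^ K /\ j < 2 ^ K.
  by split; apply: leq_ltn_trans (ltn_expl K _); rewrite ?leq_maxl ?leq_maxr.
pose f (x : gam) := (@mstate_of K 0 x).1.1.1.
have fE k : f (c_ ^+ k)%g = shift k (o0 K).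
  rewrite /f -el_nseq mstate_of_el //.
  by elim: k (o0 K) {2}(o0 K) => //= k IH r p; rewrite IH /shift -iterSr.
by have /eqP := fE i; rewrite E fE shift_inj // => /eqP.
Qed.

(** In the model with [n = m], [z_ m] flips the last bit unconditionally. *)
Lemma z_neq1 m : z_ m <> 1%g.
Proof.
move=> E; have mK : m.*2 <= 2 ^ m.*2 by exact: ltn_exp2.
have := congr1 (fun x => (@mstate_of m.*2 m x).2) E.
rewrite -el_nil !mstate_of_el // mrun_wz //= /zcond leqnn subnn.
by [].
Qed.

Lemma z_S_neq m : z_ m <> z_ m.+1.
Proof.
rewrite z_S -!mulgA -{1}[z_ m]mulg1 => /mulgI /esym E; apply: (@z_neq1 m).
by apply: (mulgI (q_ m.*2)); apply: (mulIg (q_ m.*2)); rewrite -mulgA E mulg1 q_sqr.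
Qed.

(** * Cuts *)

Definition is_z (s : letter) : bool := s.1 == (false, false).

Section Potential.
Variable kappa : gam -> bool.
Implicit Types (x : gam) (u v w : word).

(* The derivation of the header, with [kappa] the indicator of K or its image
   modulo a binary chain. *)
Definition jump x (s : letter) : bool :=
  is_z s && (kappa x (+) kappa (x * el [:: s])%g).

Fixpoint potential x w : bool :=
  if w is s :: w' then jump x s (+) potential (x * el [:: s])%g w' else false.

(** The derivation agrees on [w] with the inner one given by [kappa]; on words equal to [1] in the
    group this makes it vanish. *)
Definition inner w := forall x, potential x w = kappa x (+) kappa (x * el w)%g.
Definition null w := forall x, potential x w = false.

Lemma potential_cat x u v :
  potential x (u ++ v) = potential x u (+) potential (x * el u)%g v.
Proof.
elim: u x => [|s u IH] x /=; first by rewrite el_nil mulg1.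
by rewrite IH (el_cons s u) mulgA addbA.
Qed.

Lemma potential_winv x w : potential (x * el w)%g (winv w) = potential x w.
Proof.
elim: w x => //= s w IH x.
rewrite /winv map_cons rev_cons -cats1 potential_cat -/(winv w) (el_cons s w) mulgA IH.
rewrite el_winv mulgK /= addbF addbC; congr (_ (+) _).
by rewrite /jump el_linv mulgK /is_z /= [kappa _ (+) _]addbC.
Qed.

Lemma inner_cat u v : inner u -> inner v -> inner (u ++ v).
Proof.
move=> iu iv x; rewrite potential_cat iu iv el_cat mulgA.
by rewrite addbA addbK.
Qed.

Lemma inner_winv w : inner w -> inner (winv w).
Proof.
move=> iw x; rewrite el_winv -{1}[x](mulgVK (el w)) potential_winv iw mulgVK.
exact: addbC.
Qed.

Lemma inner_relator r : inner r -> relator r -> null r.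
Proof. by move=> ir Rr x; rewrite ir el_relator // mulg1 addbb. Qed.

Lemma null_cat u v : null u -> null v -> null (u ++ v).
Proof. by move=> nu nv x; rewrite potential_cat nu nv. Qed.

Lemma null_winv w : null w -> null (winv w).
Proof. by move=> nw x; rewrite -{1}[x](mulgVK (el w)) potential_winv nw. Qed.

Lemma null_wcomm u v : null u -> null v -> null (wcomm u v).
Proof. by move=> nu nv; do !apply: null_cat => //; exact: null_winv. Qed.

Lemma inner_wcomm u v : inner u -> inner v -> inner (wcomm u v).
Proof. by move=> iu iv; do !apply: inner_cat => //; exact: inner_winv. Qed.

Lemma null_no_z w : all (predC is_z) w -> null w.
Proof.
elim: w => //= s w IH /andP[/negPf sz /IH nw] x.
by rewrite /= nw /jump sz.
Qed.

Lemma null_wq i : null (wq i).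
Proof.
by apply: null_no_z; rewrite all_cat /= !all_nseq /= !orbT.
Qed.

Section Level.
Variable n : nat.
Hypothesis kappa_q : forall i x, i < n.*2 -> kappa (x * q_ i)%g = kappa x.
Hypothesis kappa_z : forall x, kappa (x * z_ n)%g = kappa x.

Lemma inner_wq i : i < n.*2 -> inner (wq i).
Proof. by move=> im x; rewrite null_wq -/(q_ i) kappa_q // addbb. Qed.

Lemma inner_wz m : m <= n -> inner (wz m).
Proof.
elim: m => [_ x|m IH mn] /=; first by rewrite /jump addbF.
have iz := IH (ltnW mn); have iq : inner (wq m.*2) by apply: inner_wq; lia.
exact: (inner_cat iz (inner_cat iq (inner_cat iz iq))).
Qed.

(** At [m = n] the word is inner and [kappa] is invariant under [z_ n], so the potential vanishes;
    longer words are built from null ones. *)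
Lemma null_wz m : n <= m -> null (wz m).
Proof.
have nn : null (wz n) by move=> x; rewrite inner_wz // -/(z_ n) kappa_z addbb.
elim: m => [|m IH]; rewrite leq_eqVlt => /orP[/eqP<- //|] //.
move=> nm; have nz := IH nm; have nq := @null_wq m.*2.
exact: (null_cat nz (null_cat nq (null_cat nz nq))).
Qed.

(** Relators involving [wz m] with [m <= n] are products of inner words and equal [1] in the group;
    for larger [m] their pieces are null. *)
Lemma null_relator r : relator r -> null r.
Proof.
move=> Rr; case: (Rr) => [s||m|||i j|m i im].
- by move=> x; rewrite (potential_cat x [:: s] [:: linv s]) -[[:: linv s]]/(winv [:: s])
    potential_winv addbb.
- exact: null_no_z.
- case: (leqP m n) => [mn|/ltnW nm]; last by apply: null_cat; exact: null_wz.
  by apply: inner_relator; [apply: inner_cat; exact: inner_wz|exact: rel_z].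
- exact: null_no_z.
- exact: null_no_z.
- by apply: null_wcomm; exact: null_wq.
- case: (leqP m n) => [mn|/ltnW nm].
    apply: inner_relator; last exact: rel_zq.
    by apply: inner_wcomm; [exact: inner_wz|apply: inner_wq; lia].
  by apply: null_wcomm; [exact: null_wz|exact: null_wq].
Qed.

(* The potential defines a double cover of the Cayley graph modulo [bs]; the
   relators act trivially on it, and it extends the chain [bs] by one bit. *)
Lemma potential_well_defined_mod bs u v :
  binary (@rmulg gam) bs -> (forall x y, agree bs x y -> kappa x = kappa y) ->
  el u = el v -> potential 1%g u = potential 1%g v.
Proof.
move=> Bbs kE uv.
pose act (s : letter) (x : gam * bool) := ((x.1 * el [:: s])%g, x.2 (+) jump x.1 s).
pose bits := (fun x : gam * bool => x.2) :: [seq b \o fst | b <- bs].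
have actE w (x : gam * bool) : run act x w = ((x.1 * el w)%g, x.2 (+) potential x.1 w).
  elim: w x => [[x e]|s w IH x] /=; first by rewrite el_nil mulg1 addbF.
  by rewrite IH /= (el_cons s w) mulgA addbA.
suff M : model act bits.
  have := @model_agree _ act bits u v (1%g, false) M uv.
  by rewrite !actE /= => /andP[/eqP].
split=> [|r Rr x]; last first.
  rewrite actE el_relator // mulg1 null_relator // addbF.
  by case: x => x e; exact: agreexx.
split.
  apply: (binary_pullback Bbs) => s; exists [:: el [:: s]] => y; exact: agreexx.
move=> s x y; rewrite agree_map => xy /= ->; congr (_ (+) (_ && (_ (+) _))).
  exact: kE.
by apply: kE; rewrite binary_rmulg.
Qed.

End Level.
End Potential.

Fixpoint vertices (x : gam) (w : word) : seq gam :=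
  if w is s :: w' then x :: vertices (x * el [:: s])%g w' else [:: x].

Lemma eq_potential k k' x w : {in vertices x w, k =1 k'} ->
  potential k x w = potential k' x w.
Proof.
elim: w x => //= s w IH x H; rewrite IH => [|y yw]; last first.
  by apply: H; rewrite inE yw orbT.
congr (_ (+) _); rewrite /jump !H ?mem_head // inE.
by case: w {IH H} => *; rewrite mem_head orbT.
Qed.

Section Cut.
Variable n : nat.

(** The finite group K: [z_ n] is an involution commuting with [Qs n.*2], so two cosets suffice. *)
Definition edge_group : seq gam := Qs n.*2 ++ [seq (x * z_ n)%g | x <- Qs n.*2].

Definition in_edge_group (x : gam) : bool := x \in edge_group.

Lemma edge_group_q i x : i < n.*2 -> x \in edge_group -> (x * q_ i)%g \in edge_group.
Proof.
move=> im; rewrite !mem_cat => /orP[xQ|/mapP[y yQ ->]]; apply/orP; [left|right].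
  exact: Qs_mulr.
by rewrite -mulgA z_qC // mulgA (map_f (fun x => x * z_ n)%g) // Qs_mulr.
Qed.

Lemma edge_group_z x : x \in edge_group -> (x * z_ n)%g \in edge_group.
Proof.
rewrite !mem_cat => /orP[xQ|/mapP[y yQ ->]]; apply/orP; [right|left].
  exact: (map_f (fun x => x * z_ n)%g).
by rewrite -mulgA z_sqr mulg1.
Qed.

Definition saturation bs (x : gam) : bool := has (fun k => agree bs k x) edge_group.

Lemma saturation_mulr bs h x : binary (@rmulg gam) bs -> (h * h = 1)%g ->
  (forall y, y \in edge_group -> (y * h)%g \in edge_group) ->
  saturation bs (x * h)%g = saturation bs x.
Proof.
move=> Bbs hh H; suff I y : saturation bs y -> saturation bs (y * h)%g.
  by apply/idP/idP => [/I|/I//]; rewrite -mulgA hh mulg1.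
move=> /hasP[k kK ky]; apply/hasP; exists (k * h)%g; first exact: H.
by rewrite binary_rmulg.
Qed.

Lemma in_edge_group_mulr h x : (h * h = 1)%g ->
  (forall y, y \in edge_group -> (y * h)%g \in edge_group) ->
  in_edge_group (x * h)%g = in_edge_group x.
Proof.
by move=> hh H; apply/idP/idP => [/H|/H//]; rewrite -mulgA hh mulg1.
Qed.

(** Membership in K need not factor through a binary chain, but two given words visit finitely many
    vertices. A chain separating these from each other and from K makes [saturation] agree with K
    along both words, and [saturation] does factor through it. *)
Lemma potential_well_defined u v : el u = el v ->
  potential in_edge_group 1%g u = potential in_edge_group 1%g v.
Proof.
move=> uv.
have [bs Bbs Hbs] := residually_binary_seq
  (edge_group ++ vertices 1%g u ++ vertices 1%g v) gam_residually_binary.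
have kE w : {subset vertices 1%g w <= vertices 1%g u ++ vertices 1%g v} ->
    {in vertices 1%g w, in_edge_group =1 saturation bs}.
  move=> sw x /sw xw; apply/idP/hasP => [xK|[k kK kx]].
    by exists x => //; exact: agreexx.
  by rewrite /in_edge_group -(Hbs k x) // mem_cat ?kK // xw orbT.
rewrite (eq_potential (kE u _)) => [|x xu]; last by rewrite mem_cat xu.
rewrite (eq_potential (kE v _)) => [|x xv]; last by rewrite mem_cat xv orbT.
apply: (@potential_well_defined_mod _ n _ _ bs) => // [i x im|x|x y xy].
- by apply: saturation_mulr; [|exact: q_sqr|move=> y; exact: edge_group_q].
- by apply: saturation_mulr; [|exact: z_sqr|exact: edge_group_z].
- by apply: eq_has => k; apply/idP/idP => H; apply: agree_trans H _;
     rewrite // agree_sym.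
Qed.

Definition cut (x : gam) : bool := potential in_edge_group 1%g (rep x).

Lemma cut_el w : cut (el w) = potential in_edge_group 1%g w.
Proof. by apply: potential_well_defined; rewrite repK. Qed.

Lemma cut_letter x s :
  cut (x * el [:: s])%g = cut x (+) jump in_edge_group x s.
Proof.
rewrite -{1 3}[x]repK -el_cat cut_el potential_cat /= mul1g addbF.
by rewrite repK.
Qed.

(** A letter changes the cut only when exactly one of [x] and its successor lies in the finite list
    K; longer words follow by induction. *)
Lemma cut_boundary g : exists B : seq gam, forall x,
  cut x != cut (x * g)%g -> x \in B.
Proof.
rewrite -[g]repK; elim: (rep g) => [|s w [B HB]].
  by exists [::] => x; rewrite el_nil mulg1 eqxx.
exists (edge_group ++ [seq (k * (el [:: s])^-1)%g | k <- edge_group] ++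
        [seq (y * (el [:: s])^-1)%g | y <- B]) => x.
rewrite (el_cons s w) mulgA mem_cat => H.
case: (eqVneq (cut x) (cut (x * el [:: s])%g)) => [E|].
  rewrite E in H; move/HB: H => H; apply/orP; right; rewrite mem_cat; apply/orP; right.
  by apply/mapP; exists (x * el [:: s])%g => //; rewrite mulgK.
rewrite cut_letter -{1}[cut x]addbF (inj_eq (@addbI _)) eq_sym eqbF_neg negbK.
case/andP=> _; rewrite /in_edge_group.
case: (x \in edge_group) => //= xsK; rewrite mem_cat; apply/orP; left.
by apply/mapP; exists (x * el [:: s])%g => //; rewrite mulgK.
Qed.

Lemma cut_mulc x i : cut (x * c_ ^+ i)%g = cut x.
Proof.
elim: i => [|i IH]; first by rewrite expg0 mulg1.
by rewrite expgSr mulgA cut_letter /jump addbF.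
Qed.

Lemma cut1 : cut 1%g = false.
Proof. by rewrite -el_nil cut_el. Qed.

End Cut.

(** [wz m] is inner at level [m.+1], so the cut at [z_ m] compares membership of [1] and [z_ m] in
    K. All lamps of [z_ m] are off, so in K it could only be [1] or [z_ m.+1], and it is neither. *)
Lemma cut_z m : cut m.+1 (z_ m).
Proof.
have kq i x : i < m.+1.*2 -> in_edge_group m.+1 (x * q_ i)%g = in_edge_group m.+1 x.
  move=> im; apply: in_edge_group_mulr; first exact: q_sqr.
  by move=> y; exact: edge_group_q.
rewrite cut_el (inner_wz kq) // mul1g -/(z_ m) /in_edge_group.
have -> : 1%g \in edge_group m.+1 by rewrite mem_cat mem1_Qs.
rewrite addTb mem_cat; apply/norP.
have lamp_eq x i : lamp m.+1.*2 (x * z_ m)%g i = lamp m.+1.*2 x i by exact: lamp_mulz.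
have Q1 x : x \in Qs m.+1.*2 -> (forall i, lamp m.+1.*2 x i = false) -> x = 1%g.
  move=> xQ x0; apply: (lamp_inj (ltn_exp2 m.+1.*2)) xQ (mem1_Qs _) _ => i _.
  by rewrite x0 lamp1.
have z0 k i : lamp m.+1.*2 (z_ k) i = false.
  by rewrite -[z_ k]mul1g lamp_mulz lamp1.
split; apply/negP; first by move/Q1 => /(_ (z0 m)); exact: z_neq1.
case/mapP => x xQ E; apply: (@z_S_neq m); rewrite {1}E (Q1 x) ?mul1g // => i.
by rewrite -(lamp_mulz _ x m.+1) -E z0.
Qed.

(** * Word length against the number of translates, and conclusion *)

Lemma size_wz m : size (wz m) + 8 * m + 10 = 11 * 2 ^ m.
Proof.
have size_wq i : size (wq i) = i.*2.+1.
  by rewrite size_cat /= !size_nseq; lia.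
elim: m => [|m IH] //.
have -> : wz m.+1 = wz m ++ wq m.*2 ++ wz m ++ wq m.*2 by [].
by rewrite size_cat (size_cat (wq _)) (size_cat (wz m)) size_wq expnS; lia.
Qed.

Lemma gam_obstruction N :
  inhabited (obstruction c_ [seq el [:: s] | s <- enum {: letter}] N).
Proof.
(* There are [4 ^ m] translates and [size u + 3] is at most [11 * 2 ^ m], so [N * 11 < 2 ^ m] is
   enough, and [m = N * 11] satisfies it. *)
pose m := N * 11; pose u := [seq el [:: s] | s <- wz m].
have uE : (\prod_(s <- u) s)%g = z_ m.
  rewrite big_map /z_; elim: (wz m) => [|s w IH]; first by rewrite big_nil.
  by rewrite big_cons IH -el_cons.
constructor; apply: (@Obstruction _ _ _ _ (Qs m.*2) u (cut m.+1)); rewrite ?uE.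
- exact/uniq_Qs/ltn_exp2.
- rewrite size_Qs size_map -addnn expnD.
  apply: (@leq_ltn_trans (N * 11 * 2 ^ m)); last by rewrite ltn_mul2r expn_gt0 ltn_expl.
  by rewrite -mulnA leq_mul2l; have := size_wz m; lia.
- by move=> _ /mapP[s _ ->]; apply: map_f; rewrite mem_enum.
- by apply: Qs_comm => i _; rewrite c_qC.
- by apply: Qs_comm => i im; rewrite z_qC.
- exact: Qs_c_indep.
- exact: cut_boundary.
- by move=> i; rewrite -[(c_ ^+ i)%g]mul1g cut_mulc cut1.
- by move=> i; rewrite cut_mulc cut_z.
Qed.

Theorem theorem8 :
  exists Gam : groupType,
    [/\ finitely_generated Gam,
        uniform_tww Gam <> None,
        ~ accessible_group Gam &
        forall S : {fset Gam}, generates S ->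
          strict_tww (cayley S) <> None /\ ~ accessible (cayley S)].
Proof.
(* The obstructions do not refer to [S], so one family of them serves every generating set. *)
have inacc (S : {fset gam}) : generates S -> ~ accessible (cayley S).
  move=> genS; exact: (not_accessible_of_obstructions genS c_inj gam_obstruction).
exists gam; split.
- exact: gam_finitely_generated.
- exact: gam_uniform_tww.
- by move=> [S /inacc].
- move=> S genS; split; last exact: inacc.
  by apply: strict_tww_finite; exact: gam_residually_binary.
Qed.
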